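(* Let $n\ge2$ and let $R$ be a commutative ring with unit. For any $R$-valued Magnus expansion $\theta$ of the free group $F_n$ and each $p\ge1$, $$h_p=(\varsigma_p)_*([\tau^\theta_1]^{\otimes p})\in H^p(\mathrm{Aut}(F_n);H^*\otimes H^{\otimes(p+1)}).$$ In the case $p=1$ we have $[\tau^\theta_1]=h_1\in H^1(\mathrm{Aut}(F_n);H^*\otimes H^{\otimes2})$, which is independent of the choice of $\theta$.
   Context: $R$ is a commutative ring with unit, $F_n$ a free group of rank $n\ge2$, $H=H_1(F_n;R)$, $H^*=\mathrm{Hom}_R(H,R)$ (the dual module), tensor products and Hom over $R$; $[\gamma]\in H$ is the class of $\gamma\in F_n$; $\mathrm{Aut}(F_n)$ acts on $H$, $\varphi$ acting as $|\varphi|$. First Johnson map: let $\widehat T=\prod_{m\ge0}H^{\otimes m}$, $\widehat T_p=\prod_{m\ge p}H^{\otimes m}$. A Magnus expansion is a group homomorphism $\theta:F_n\to1+\widehat T_1$ with $\theta(\gamma)\equiv1+[\gamma]\pmod{\widehat T_2}$; let $\theta_2(\gamma)\in H^{\otimes2}$ be its degree-2 component. The first Johnson map $\tau^\theta_1:\mathrm{Aut}(F_n)\to\mathrm{Hom}(H,H^{\otimes2})=H^*\otimes H^{\otimes2}$ is characterized by $\tau^\theta_1(\varphi)[\gamma]=\theta_2(\gamma)-|\varphi|^{\otimes2}\theta_2(\varphi^{-1}(\gamma))$. It is a 1-cocycle, with class $[\tau^\theta_1]$. Conventions: group cochains are normalized inhomogeneous cochains, a 1-cocycle satisfies $f(xy)=f(x)+xf(y)$,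 and cup products (also denoted by $\otimes$ and tensor powers of classes) are Alexander–Whitney: $(f\cup g)(x_1,\dots,x_p,y_1,\dots,y_q)=f(x_1,\dots,x_p)\otimes x_1\cdots x_p\,g(y_1,\dots,y_q)$. The classes $h_p$: let $\overline{A_n}=F_n\rtimes\mathrm{Aut}(F_n)$ with $(\gamma_1,\varphi_1)(\gamma_2,\varphi_2)=(\gamma_1\varphi_1(\gamma_2),\varphi_1\varphi_2)$ and projection $\pi:\overline{A_n}\to\mathrm{Aut}(F_n)$ with kernel $F_n$. The map $k_0:\overline{A_n}\to H$, $(\gamma,\varphi)\mapsto[\gamma]$, is a 1-cocycle; write also $k_0\in H^1(\overline{A_n};H)$. For an $\mathrm{Aut}(F_n)$-module $M$ which is an $R$-module and on which $F_n$ acts trivially, $\pi_\sharp:H^{p+1}(\overline{A_n};M)\to H^p(\mathrm{Aut}(F_n);H^1(F_n;M))=H^p(\mathrm{Aut}(F_n);\mathrm{Hom}(H,M))$ is the Gysin map, i.e. the edge map of the Lyndon–Hochschild–Serre spectral sequence, with the Hochschild–Serre sign convention: every class is represented by a normalized cocycle $f$ vanishing whenever at least two of its arguments lie in $F_n$, and $\pi_\sharp[f]$ is represented by $$(\varphi_1,\dots,\varphi_p)\mapsto\Big([\gamma]\mapsto\sum_{i=0}^p(-1)^if(\varphi_1,\dots,\varphi_i,(\varphi_1\cdots\varphi_i)^{-1}(\gamma),\varphi_{i+1},\dots,\varphi_p)\Big),$$ where $\varphi_j$ stands for $(1,\varphi_j)$ and elements of $F_n$ for $(\gamma,1)$. Define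 $h_p:=\pi_\sharp(k_0^{\otimes(p+1)})\in H^p(\mathrm{Aut}(F_n);H^*\otimes H^{\otimes(p+1)})$ for $p\ge1$. The map $\varsigma_p:\mathrm{Hom}(H,H^{\otimes2})^{\otimes p}\to\mathrm{Hom}(H,H^{\otimes(p+1)})=H^*\otimes H^{\otimes(p+1)}$ is the $GL(H)$-homomorphism given for $p\ge2$ by $\varsigma_p(u_{(1)}\otimes\cdots\otimes u_{(p)})=(u_{(1)}\otimes1_H^{\otimes(p-1)})\circ(u_{(2)}\otimes1_H^{\otimes(p-2)})\circ\cdots\circ(u_{(p-1)}\otimes1_H)\circ u_{(p)}$, and $\varsigma_1$ is the identity. *)

(* Defs.v *)
From HB Require Import structures.
From mathcomp Require Import all_boot all_algebra.
From mathcomp Require Import boolp classical_sets.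

Set Implicit Arguments.
Unset Strict Implicit.
Unset Printing Implicit Defensive.

Import GRing.Theory.
Local Open Scope ring_scope.

Lemma linear_ext (R : pzRingType) (U V : lmodType R) (f g : {linear U -> V}) :
  f =1 g -> f = g.
Proof.
case: f => f [[fD] [fZ]]; case: g => g [[gD] [gZ]] /= /funext efg.
case: _ / efg in gD gZ *.
by rewrite (Prop_irrelevance gD fD) (Prop_irrelevance gZ fZ).
Qed.

Definition mklin (R : pzRingType) (U V : lmodType R) (f : U -> V)
    (fP : linear f) : {linear U -> V} :=
  HB.pack f (GRing.isLinear.Build R U V _ f fP).

Lemma mklinE (R : pzRingType) (U V : lmodType R) (f : U -> V) (fP : linear f) x :
  mklin fP x = f x.
Proof. by []. Qed.

Lemma lcompE (R : pzRingType) (U V W : lmodType R) (g : {linear V -> W})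
    (f : {linear U -> V}) x : (g \o f : {linear U -> W}) x = g (f x).
Proof. by []. Qed.

Section HomModule.
Variables (R : comPzRingType) (U V : lmodType R).
Implicit Types f g : {linear U -> V}.

HB.instance Definition _ := gen_eqMixin {linear U -> V}.
HB.instance Definition _ := gen_choiceMixin {linear U -> V}.

Definition lhom0 : {linear U -> V} := \0.
Definition lhom_opp f : {linear U -> V} := \- f.
Definition lhom_add f g : {linear U -> V} := f \+ g.

Lemma lhom_scale_linear (a : R) f : linear (fun x => a *: f x).
Proof.
by move=> b x y; rewrite linearP scalerDr !scalerA mulrC.
Qed.
Definition lhom_scale (a : R) f : {linear U -> V} :=
  mklin (lhom_scale_linear a f).

Lemma lhom_addA : associative lhom_add.
Proof. by move=> f g h; apply: linear_ext => x /=; rewrite addrA. Qed.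
Lemma lhom_addC : commutative lhom_add.
Proof. by move=> f g; apply: linear_ext => x /=; rewrite addrC. Qed.
Lemma lhom_add0 : left_id lhom0 lhom_add.
Proof. by move=> f; apply: linear_ext => x /=; rewrite add0r. Qed.
Lemma lhom_addN : left_inverse lhom0 lhom_opp lhom_add.
Proof. by move=> f; apply: linear_ext => x /=; rewrite addNr. Qed.
HB.instance Definition _ := GRing.isZmodule.Build {linear U -> V}
  lhom_addA lhom_addC lhom_add0 lhom_addN.

Lemma lhom_scaleA a b f :
  lhom_scale a (lhom_scale b f) = lhom_scale (a * b) f.
Proof. by apply: linear_ext => x /=; rewrite scalerA. Qed.
Lemma lhom_scale1 : left_id 1 lhom_scale.
Proof. by move=> f; apply: linear_ext => x /=; rewrite scale1r. Qed.
Lemma lhom_scaleDr : right_distributive lhom_scale +%R.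
Proof. by move=> a f g; apply: linear_ext => x /=; rewrite scalerDr. Qed.
Lemma lhom_scaleDl f : {morph lhom_scale^~ f : a b / a + b}.
Proof. by move=> a b; apply: linear_ext => x /=; rewrite scalerDl. Qed.
HB.instance Definition _ := GRing.Zmodule_isLmodule.Build R {linear U -> V}
  lhom_scaleA lhom_scale1 lhom_scaleDr lhom_scaleDl.

Lemma lhomDE f g x : (f + g) x = f x + g x. Proof. by []. Qed.
Lemma lhomZE a f x : (a *: f) x = a *: f x. Proof. by []. Qed.

End HomModule.

Section Presentation.
Variables (R : pzRingType) (X : Type).

(* The module with generators X and relations [rel] is the set of formal linear
   expressions [lterm] modulo [lcong], the least congruence that contains [rel]
   and satisfies the axioms of R-modules. *)
Inductive lterm : Type :=
| LZero
| LGen of X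
| LAdd of lterm & lterm
| LScale of R & lterm.

HB.instance Definition _ := gen_eqMixin lterm.
HB.instance Definition _ := gen_choiceMixin lterm.

Fixpoint leval (M : lmodType R) (f : X -> M) (t : lterm) : M :=
  match t with
  | LZero => 0
  | LGen x => f x
  | LAdd s t => leval f s + leval f t
  | LScale a t => a *: leval f t
  end.

Variable rel : lterm -> lterm -> Prop.

Inductive lcong : lterm -> lterm -> Prop :=
| lcong_rel s t of rel s t : lcong s t
| lcong_refl t : lcong t t
| lcong_sym s t of lcong s t : lcong t s
| lcong_trans s t u of lcong s t & lcong t u : lcong s u
| lcong_add s s' t t' of lcong s s' & lcong t t' :
    lcong (LAdd s t) (LAdd s' t')
| lcong_scale a t t' of lcong t t' : lcong (LScale a t) (LScale a t')
| lcong_addA s t u : lcong (LAdd s (LAdd t u)) (LAdd (LAdd s t) u)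
| lcong_addC s t : lcong (LAdd s t) (LAdd t s)
| lcong_add0 t : lcong (LAdd LZero t) t
| lcong_addN t : lcong (LAdd (LScale (-1) t) t) LZero
| lcong_scaleA a b t : lcong (LScale a (LScale b t)) (LScale (a * b) t)
| lcong_scale1 t : lcong (LScale 1 t) t
| lcong_scaleDr a s t :
    lcong (LScale a (LAdd s t)) (LAdd (LScale a s) (LScale a t))
| lcong_scaleDl a b t :
    lcong (LScale (a + b) t) (LAdd (LScale a t) (LScale b t)).

Definition lcongb s t := `[< lcong s t >].

Lemma lcongb_refl : reflexive lcongb.
Proof. by move=> t; apply/asboolP; apply: lcong_refl. Qed.
Lemma lcongb_sym : symmetric lcongb.
Proof. by move=> s t; apply/asboolP/asboolP; apply: lcong_sym. Qed.
Lemma lcongb_trans : transitive lcongb.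
Proof.
by move=> t s u /asboolP st /asboolP tu; apply/asboolP; apply: lcong_trans tu.
Qed.
Canonical lcong_equiv := EquivRel lcongb lcongb_refl lcongb_sym lcongb_trans.

Definition presented := {eq_quot lcong_equiv}%qT.
HB.instance Definition _ := Choice.on presented.
HB.instance Definition _ := EqQuotient.on presented.

Definition pclass (t : lterm) : presented := (\pi_presented t)%qT.

Lemma pclassP s t : pclass s = pclass t <-> lcong s t.
Proof.
rewrite /pclass; split=> [/eqmodP /asboolP //|st]; apply/eqmodP.
exact/asboolP.
Qed.

Lemma pclassK (x : presented) : pclass (repr x) = x.
Proof. exact: reprK. Qed.

Lemma lcong_repr t : lcong (repr (pclass t)) t.
Proof. by apply/pclassP; rewrite pclassK. Qed.

Lemma presentedW (P : presented -> Prop) : (forall t, P (pclass t)) -> forall x, P x.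
Proof. by move=> Pt x; rewrite -(pclassK x). Qed.

Definition padd (x y : presented) := pclass (LAdd (repr x) (repr y)).
Definition pscale a (x : presented) := pclass (LScale a (repr x)).
Definition popp (x : presented) := pscale (-1) x.

Lemma paddE s t : padd (pclass s) (pclass t) = pclass (LAdd s t).
Proof. by apply/pclassP; apply: lcong_add; apply: lcong_repr. Qed.
Lemma pscaleE a t : pscale a (pclass t) = pclass (LScale a t).
Proof. by apply/pclassP; apply: lcong_scale; apply: lcong_repr. Qed.

Lemma paddA : associative padd.
Proof.
elim/presentedW=> s; elim/presentedW=> t; elim/presentedW=> u.
by rewrite !paddE; apply/pclassP; apply: lcong_addA.
Qed.
Lemma paddC : commutative padd.
Proof.
elim/presentedW=> s; elim/presentedW=> t.
by rewrite !paddE; apply/pclassP; apply: lcong_addC.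
Qed.
Lemma padd0 : left_id (pclass LZero) padd.
Proof.
by elim/presentedW=> s; rewrite !paddE; apply/pclassP; apply: lcong_add0.
Qed.
Lemma paddN : left_inverse (pclass LZero) popp padd.
Proof.
elim/presentedW=> s; rewrite /popp pscaleE paddE.
by apply/pclassP; apply: lcong_addN.
Qed.
HB.instance Definition _ :=
  GRing.isZmodule.Build presented paddA paddC padd0 paddN.

Lemma pclassD s t : pclass s + pclass t = pclass (LAdd s t).
Proof. exact: paddE. Qed.

Lemma pscaleA a b x : pscale a (pscale b x) = pscale (a * b) x.
Proof.
elim/presentedW: x => s; rewrite !pscaleE.
by apply/pclassP; apply: lcong_scaleA.
Qed.
Lemma pscale1 : left_id 1 pscale.
Proof.
by elim/presentedW=> s; rewrite pscaleE; apply/pclassP; apply: lcong_scale1.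
Qed.
Lemma pscaleDr : right_distributive pscale +%R.
Proof.
move=> a; elim/presentedW=> s; elim/presentedW=> t.
rewrite pclassD !pscaleE pclassD.
by apply/pclassP; apply: lcong_scaleDr.
Qed.
Lemma pscaleDl x : {morph pscale^~ x : a b / a + b}.
Proof.
move=> a b; elim/presentedW: x => t; rewrite !pscaleE pclassD.
by apply/pclassP; apply: lcong_scaleDl.
Qed.
HB.instance Definition _ := GRing.Zmodule_isLmodule.Build R presented
  pscaleA pscale1 pscaleDr pscaleDl.

Lemma pclassZ a t : a *: pclass t = pclass (LScale a t).
Proof. exact: pscaleE. Qed.

Definition pgen (x : X) : presented := pclass (LGen x).

Lemma pclass_leval t : pclass t = leval pgen t.
Proof.
by elim: t => //= [s IHs t IHt|a t IHt]; rewrite -?IHs -IHt ?pclassD ?pclassZ.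
Qed.

Section Lift.
Variables (M : lmodType R) (f : X -> M).
Hypothesis frel : forall s t, rel s t -> leval f s = leval f t.

Lemma leval_lcong s t : lcong s t -> leval f s = leval f t.
Proof.
elim=> {s t} //=.
- by move=> s t u _ -> _ ->.
- by move=> s s' t t' _ -> _ ->.
- by move=> a t t' _ ->.
- by move=> s t u; rewrite addrA.
- by move=> s t; rewrite addrC.
- by move=> t; rewrite add0r.
- by move=> t; rewrite scaleN1r addNr.
- by move=> a b t; rewrite scalerA.
- by move=> t; rewrite scale1r.
- by move=> a s t; rewrite scalerDr.
- by move=> a b t; rewrite scalerDl.
Qed.

Definition plift_fun (x : presented) : M := leval f (repr x).

Lemma plift_funE t : plift_fun (pclass t) = leval f t.
Proof. exact/leval_lcong/lcong_repr. Qed.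

Lemma plift_linear : linear plift_fun.
Proof.
move=> a; elim/presentedW=> s; elim/presentedW=> t.
by rewrite pclassZ pclassD !plift_funE.
Qed.
Definition plift : {linear presented -> M} := mklin plift_linear.

Lemma pliftE x : plift (pgen x) = f x.
Proof. exact: plift_funE. Qed.

End Lift.

Lemma plinear_ext (M : lmodType R) (f g : {linear presented -> M}) :
  (forall x, f (pgen x) = g (pgen x)) -> f = g.
Proof.
move=> efg; apply: linear_ext; elim/presentedW=> t; rewrite pclass_leval.
elim: t => [|x|s IHs t IHt|a t IHt] /=; first by rewrite !linear0.
- exact: efg.
- by rewrite !linearD IHs IHt.
- by rewrite !linearZZ IHt.
Qed.

End Presentation.

Section Tensor.
Variables (R : comPzRingType) (U V : lmodType R).

Inductive tens_rel : lterm R (U * V) -> lterm R (U * V) -> Prop :=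
| TensDl u u' v :
    tens_rel (LGen R (u + u', v)) (LAdd (LGen R (u, v)) (LGen R (u', v)))
| TensZl a u v : tens_rel (LGen R (a *: u, v)) (LScale a (LGen R (u, v)))
| TensDr u v v' :
    tens_rel (LGen R (u, v + v')) (LAdd (LGen R (u, v)) (LGen R (u, v')))
| TensZr a u v : tens_rel (LGen R (u, a *: v)) (LScale a (LGen R (u, v))).

Definition tensor : lmodType R := presented tens_rel.

Definition tens (u : U) (v : V) : tensor := pgen tens_rel (u, v).

Definition bilinear_map (M : lmodType R) (b : U -> V -> M) : Prop :=
  (forall v, linear (b^~ v)) /\ (forall u, linear (b u)).

Lemma tens_bilinear : bilinear_map tens.
Proof.
have lin s t : tens_rel s t -> pclass tens_rel s = pclass tens_rel t.
  by move=> st; apply/pclassP/lcong_rel.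
split=> [v a u u'|u a v v'].
- rewrite /tens [LHS](lin _ _ (TensDl _ _ _)) -[LHS]pclassD.
  by rewrite [pclass _ (LGen _ _) in LHS](lin _ _ (TensZl _ _ _)) -pclassZ.
- rewrite /tens [LHS](lin _ _ (TensDr _ _ _)) -[LHS]pclassD.
  by rewrite [pclass _ (LGen _ _) in LHS](lin _ _ (TensZr _ _ _)) -pclassZ.
Qed.

Section TensorLift.
Variables (M : lmodType R) (b : U -> V -> M).
Hypothesis bP : bilinear_map b.

Lemma tlift_rel s t :
  tens_rel s t -> leval (fun w => b w.1 w.2) s = leval (fun w => b w.1 w.2) t.
Proof.
case: bP => bl br.
pose bL v := mklin (bl v); pose bR u := mklin (br u).
case=> {s t} [u u' v|a u v|u v v'|a u v] /=.
- exact: (linearD (bL v)).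
- exact: (linearZZ (bL v)).
- exact: (linearD (bR u)).
- exact: (linearZZ (bR u)).
Qed.

Definition tlift : {linear tensor -> M} := plift tlift_rel.

Lemma tliftE u v : tlift (tens u v) = b u v.
Proof. exact: pliftE. Qed.

End TensorLift.

Lemma tensor_ext (M : lmodType R) (f g : {linear tensor -> M}) :
  (forall u v, f (tens u v) = g (tens u v)) -> f = g.
Proof. by move=> efg; apply: plinear_ext => -[u v]; apply: efg. Qed.

Lemma tensDl u u' v : tens (u + u') v = tens u v + tens u' v.
Proof. exact: (linearD (mklin (tens_bilinear.1 v))). Qed.
Lemma tensDr u v v' : tens u (v + v') = tens u v + tens u v'.
Proof. exact: (linearD (mklin (tens_bilinear.2 u))). Qed.
Lemma tensZl a u v : tens (a *: u) v = a *: tens u v.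
Proof. exact: (linearZZ (mklin (tens_bilinear.1 v))). Qed.
Lemma tensZr a u v : tens u (a *: v) = a *: tens u v.
Proof. exact: (linearZZ (mklin (tens_bilinear.2 u))). Qed.
Lemma tens0l v : tens 0 v = 0.
Proof. exact: (linear0 (mklin (tens_bilinear.1 v))). Qed.
Lemma tens0r u : tens u 0 = 0.
Proof. exact: (linear0 (mklin (tens_bilinear.2 u))). Qed.
Lemma tensNl u v : tens (- u) v = - tens u v.
Proof. exact: (linearN (mklin (tens_bilinear.1 v))). Qed.
Lemma tensNr u v : tens u (- v) = - tens u v.
Proof. exact: (linearN (mklin (tens_bilinear.2 u))). Qed.
Lemma tensBl u u' v : tens (u - u') v = tens u v - tens u' v.
Proof. exact: (linearB (mklin (tens_bilinear.1 v))). Qed.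
Lemma tensBr u v v' : tens u (v - v') = tens u v - tens u v'.
Proof. exact: (linearB (mklin (tens_bilinear.2 u))). Qed.

End Tensor.

Section TensorMap.
Variables (R : comPzRingType) (U U' V V' : lmodType R).
Variables (f : {linear U -> U'}) (g : {linear V -> V'}).

Lemma tmap_bilinear : bilinear_map (fun u v => tens (f u) (g v)).
Proof.
by split=> [v a u u'|u a v v']; rewrite linearP (tensDl, tensDr) (tensZl, tensZr).
Qed.

Definition tmap : {linear tensor U V -> tensor U' V'} := tlift tmap_bilinear.

Lemma tmapE u v : tmap (tens u v) = tens (f u) (g v).
Proof. exact: tliftE. Qed.

End TensorMap.

(* [tpow V m] is the [m]-th tensor power of [V], with the factors bracketed to
   the right: V (x) (V (x) ... (V (x) R)). *)
Section TensorPower.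
Variable R : comPzRingType.

Fixpoint tpow (V : lmodType R) (m : nat) : lmodType R :=
  if m is m'.+1 then tensor V (tpow V m') else R^o.

Definition tunit (V : lmodType R) : tpow V 0 := (1 : R).

(* The inclusion of the degree 1 part, V = V (x) R. *)
Definition tdeg1 (V : lmodType R) (v : V) : tpow V 1 := tens v (tunit V).

Fixpoint tpow_map (V W : lmodType R) (f : {linear V -> W}) (m : nat) :
    {linear tpow V m -> tpow W m} :=
  if m is m'.+1 then tmap f (tpow_map f m') else idfun.

Lemma tpow_mapS (V W : lmodType R) (f : {linear V -> W}) m v t :
  tpow_map f m.+1 (tens v t) = tens (f v) (tpow_map f m t).
Proof. exact: tmapE. Qed.

Section Concat.
Variable V : lmodType R.

Lemma scaler_linear (j : nat) (s : tpow V j) :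
  linear (fun r : tpow V 0 => (r : R) *: s).
Proof. by move=> a r r'; rewrite scalerDl scalerA. Qed.

(* Right multiplication by [s] in the tensor algebra of [V]. *)
Fixpoint tmulr (j : nat) (s : tpow V j) (i : nat) :
    {linear tpow V i -> tpow V (i + j)} :=
  if i is i'.+1 then tmap (idfun : {linear V -> V}) (tmulr s i')
  else mklin (scaler_linear s).

Definition tcat (i j : nat) (t : tpow V i) (s : tpow V j) : tpow V (i + j) :=
  tmulr s i t.

Lemma tcat0 j (r : R) (s : tpow V j) : @tcat 0 j r s = r *: s.
Proof. by []. Qed.
Lemma tcatS i j v (t : tpow V i) (s : tpow V j) :
  @tcat i.+1 j (tens v t) s = tens v (tcat t s).
Proof. exact: tmapE. Qed.

Lemma tcat_linearl i j (s : tpow V j) : linear (fun t : tpow V i => tcat t s).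
Proof. exact: linearPZ. Qed.

Lemma tcat_linearr i j (t : tpow V i) : linear (@tcat i j t).
Proof.
move=> a s s'; rewrite /tcat.
suff -> : tmulr (a *: s + s') i = a *: tmulr s i + tmulr s' i by [].
elim: i {t} => [|i IHi].
  apply: linear_ext => r; rewrite lhomDE lhomZE /=.
  by rewrite scalerDr !scalerA mulrC.
apply: tensor_ext => v t.
have E s0 : tmulr s0 i.+1 (tens v t) = tens v (tmulr s0 i t) by exact: tmapE.
by rewrite lhomDE lhomZE !E IHi lhomDE lhomZE tensDr tensZr.
Qed.

Lemma tcat_unit2 (t : tpow V 2) : tcat t (tunit V) = t.
Proof.
have e i : tmulr (tunit V) i.+1 = tmap idfun (tmulr (tunit V) i) by [].
have e0 : tmulr (tunit V) 0 = (idfun : {linear tpow V 0 -> tpow V 0}).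
  by apply: linear_ext => r; exact: mulr1.
have e1 : tmulr (tunit V) 1 = (idfun : {linear tpow V 1 -> tpow V 1}).
  by apply: tensor_ext => x y; rewrite e tmapE e0.
have e2 : tmulr (tunit V) 2 = (idfun : {linear tpow V 2 -> tpow V 2}).
  by apply: tensor_ext => x y; rewrite e tmapE e1.
by rewrite /tcat e2.
Qed.

Definition tcast (i j : nat) (e : i = j) (t : tpow V i) : tpow V j :=
  ecast k (tpow V k) e t.

End Concat.

Lemma tpow_map_comp (U V W : lmodType R) (g : {linear V -> W})
    (f : {linear U -> V}) m (t : tpow U m) :
  tpow_map (g \o f) m t = tpow_map g m (tpow_map f m t).
Proof.
suff -> : tpow_map (g \o f) m = tpow_map g m \o tpow_map f m by [].
elim: m {t} => [|m IHm]; first exact: linear_ext.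
by apply: tensor_ext => u t; rewrite lcompE !tpow_mapS IHm lcompE.
Qed.

Lemma tpow_map_id (V : lmodType R) (f : {linear V -> V}) m (t : tpow V m) :
  f =1 id -> tpow_map f m t = t.
Proof.
move=> f1; suff -> : tpow_map f m = idfun by [].
elim: m {t} => [|m IHm]; first exact: linear_ext.
by apply: tensor_ext => u t; rewrite tpow_mapS IHm f1.
Qed.

Lemma tpow_map_cat (V W : lmodType R) (f : {linear V -> W}) i j
    (t : tpow V i) (s : tpow V j) :
  tpow_map f (i + j) (tcat t s) = tcat (tpow_map f i t) (tpow_map f j s).
Proof.
rewrite /tcat.
suff: (tpow_map f (i + j) \o tmulr s i : {linear tpow V i -> tpow W (i + j)}) =
      tmulr (tpow_map f j s) i \o tpow_map f i.
  move=> e.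
  exact: (congr1 (fun h : {linear tpow V i -> tpow W (i + j)} => h t) e).
elim: i {t} => [|i IHi].
  by apply: linear_ext => r /=; rewrite linearZZ.
apply: tensor_ext => v t; rewrite !lcompE tpow_mapS.
rewrite [tmulr s i.+1 _]tcatS [RHS]tcatS tpow_mapS; congr tens.
exact: (congr1 (fun h : {linear _ -> _} => h t) IHi).
Qed.

End TensorPower.

Section Varsigma.
Variables (R : comPzRingType) (V : lmodType R).
Local Notation HomV2 := {linear V -> tpow V 2}.

Lemma tens_idr_bilinear (u : HomV2) k :
  bilinear_map (fun v (t : tpow V k) => tcat (u v) t).
Proof.
split=> [t|v]; last exact: tcat_linearr.
by move=> a v v'; rewrite linearP tcat_linearl.
Qed.

Definition tens_idr (u : HomV2) k : {linear tpow V k.+1 -> tpow V k.+2} :=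
  tlift (tens_idr_bilinear u k).

Lemma tens_idrE u k v (t : tpow V k) : tens_idr u k (tens v t) = tcat (u v) t.
Proof. exact: tliftE. Qed.

Lemma tens_idr_linear k : linear (fun u => tens_idr u k).
Proof.
move=> a u u'; apply: tensor_ext => v t.
rewrite [RHS]lhomDE lhomZE !tens_idrE lhomDE lhomZE.
exact: (tcat_linearl t a (u v) (u' v)).
Qed.

Lemma tdeg1_linear : linear (@tdeg1 R V).
Proof. by move=> a v w; rewrite /tdeg1 tensDl tensZl. Qed.

Lemma varsigma0_linear :
  linear (fun r : R^o => (r : R) *: (mklin tdeg1_linear : {linear V -> tpow V 1})).
Proof. by move=> a r r'; rewrite scalerDl scalerA. Qed.

Lemma varsigmaS_bilinear p (w : {linear tpow HomV2 p -> {linear V -> tpow V p.+1}}) :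
  bilinear_map (fun (u : HomV2) (x : tpow HomV2 p) =>
    (tens_idr u p \o w x : {linear V -> tpow V p.+2})).
Proof.
split=> [x a u u'|u a x x']; apply: linear_ext => v.
- by rewrite [RHS]lhomDE lhomZE !lcompE tens_idr_linear lhomDE lhomZE.
- by rewrite [RHS]lhomDE lhomZE !lcompE linearP lhomDE lhomZE linearP.
Qed.

(* The recursion varsigma_{p+1}(u (x) x) = (u (x) 1^{(x) p}) o varsigma_p(x)
   unrolls to (u_1 (x) 1^{(x)(p-1)}) o ... o (u_{p-1} (x) 1) o u_p.
   [varsigma 0] sends 1 to the identity of V, read as a map to V (x) R; it only
   serves to start the recursion. *)
Fixpoint varsigma p : {linear tpow HomV2 p -> {linear V -> tpow V p.+1}} :=
  if p is p'.+1 then tlift (varsigmaS_bilinear (varsigma p'))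
  else mklin varsigma0_linear.

Lemma varsigma0E r v : varsigma 0 r v = (r : R) *: tdeg1 v.
Proof. by []. Qed.

Lemma varsigmaSE p u x :
  varsigma p.+1 (tens u x) =
    (tens_idr u p \o varsigma p x : {linear V -> tpow V p.+2}).
Proof. exact: tliftE. Qed.

Lemma varsigma1E u : varsigma 1 (tdeg1 u) = u.
Proof.
apply: linear_ext => v; rewrite varsigmaSE lcompE varsigma0E scale1r tens_idrE.
exact: tcat_unit2.
Qed.

End Varsigma.

Definition free_basis (F : groupType) (I : Type) (x : I -> F) : Prop :=
  forall (G : groupType) (y : I -> G),
    exists! f : F -> G, {morph f : a b / (a * b)%g} /\ forall i, f (x i) = y i.

Section AutomorphismGroup.
Variable F : groupType.

Record autgroup : Type := Autgroup {
  aut_fun :> F -> F;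
  aut_inv : F -> F;
  aut_morph : {morph aut_fun : a b / (a * b)%g};
  aut_funK : cancel aut_fun aut_inv;
  aut_invK : cancel aut_inv aut_fun
}.

Lemma autgroup_ext (f g : autgroup) : aut_fun f =1 aut_fun g -> f = g.
Proof.
case: f => f f' fM fK f'K; case: g => g g' gM gK g'K /= /funext efg.
case: _ / efg in gM gK g'K *.
have e' : f' = g' by apply: funext => a; rewrite -[a in RHS]f'K gK.
case: _ / e' in gK g'K *.
by rewrite (Prop_irrelevance gM fM) (Prop_irrelevance gK fK)
           (Prop_irrelevance g'K f'K).
Qed.

HB.instance Definition _ := gen_eqMixin autgroup.
HB.instance Definition _ := gen_choiceMixin autgroup.

Definition aut_one : autgroup :=
  @Autgroup id id (fun _ _ => erefl) (fun _ => erefl) (fun _ => erefl).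

Definition aut_mul (f g : autgroup) : autgroup :=
  @Autgroup (f \o g) (aut_inv g \o aut_inv f)
    (fun a b => etrans (congr1 f (aut_morph g a b)) (aut_morph f (g a) (g b)))
    (can_comp (aut_funK f) (aut_funK g)) (can_comp (aut_invK g) (aut_invK f)).

Definition aut_inverse (f : autgroup) : autgroup :=
  @Autgroup (aut_inv f) f (can2_gmulfM (f := HB.pack (aut_fun f)
    (isMultiplicative.Build F F (aut_fun f) (aut_morph f)))
    (aut_funK f) (aut_invK f)) (aut_invK f) (aut_funK f).

Lemma aut_mulA : associative aut_mul.
Proof. by move=> f g h; apply: autgroup_ext. Qed.
Lemma aut_mul1 : left_id aut_one aut_mul.
Proof. by move=> f; apply: autgroup_ext. Qed.
Lemma aut_mulr1 : right_id aut_one aut_mul.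
Proof. by move=> f; apply: autgroup_ext. Qed.
Lemma aut_mulV : left_inverse aut_one aut_inverse aut_mul.
Proof. by move=> f; apply: autgroup_ext => a; apply: aut_funK. Qed.
Lemma aut_mulrV : right_inverse aut_one aut_inverse aut_mul.
Proof. by move=> f; apply: autgroup_ext => a; apply: aut_invK. Qed.
HB.instance Definition _ := isGroup.Build autgroup
  aut_mulA aut_mul1 aut_mulr1 aut_mulV aut_mulrV.

Lemma autM (f g : autgroup) a : (f * g)%g a = f (g a). Proof. by []. Qed.
Lemma aut1 a : (1%g : autgroup) a = a. Proof. by []. Qed.
Lemma autVK (f : autgroup) a : f (f^-1%g a) = a.
Proof. exact: aut_invK. Qed.
Lemma aut_morph1 (f : autgroup) : f 1%g = 1%g.
Proof. by apply: (mulgI (f 1%g)); rewrite -aut_morph !mulg1. Qed.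

(* The semidirect product F x| Aut F; [Holo a 1] is the copy of [a] in F and
   [Holo 1 phi] the copy of [phi] in Aut F. *)
Record holomorph : Type := Holo { hol_el : F; hol_aut : autgroup }.

HB.instance Definition _ := gen_eqMixin holomorph.
HB.instance Definition _ := gen_choiceMixin holomorph.

Definition hol_one : holomorph := Holo 1%g 1%g.
Definition hol_mul (x y : holomorph) : holomorph :=
  Holo (hol_el x * hol_aut x (hol_el y))%g (hol_aut x * hol_aut y)%g.
Definition hol_inv (x : holomorph) : holomorph :=
  Holo ((hol_aut x)^-1%g (hol_el x)^-1%g) (hol_aut x)^-1%g.

Lemma hol_mulA : associative hol_mul.
Proof.
by move=> x y z; rewrite /hol_mul /= aut_morph !mulgA.
Qed.
Lemma hol_mul1 : left_id hol_one hol_mul.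
Proof. by case=> a f; congr Holo; rewrite ?mul1g. Qed.
Lemma hol_mulr1 : right_id hol_one hol_mul.
Proof. by case=> a f; congr Holo; rewrite ?mulg1 //= aut_morph1 mulg1. Qed.
Lemma hol_mulV : left_inverse hol_one hol_inv hol_mul.
Proof.
by case=> a f; congr Holo; rewrite ?mulVg // -aut_morph mulVg aut_morph1.
Qed.
Lemma hol_mulrV : right_inverse hol_one hol_inv hol_mul.
Proof. by case=> a f; congr Holo; rewrite ?mulgV // autVK mulgV. Qed.
HB.instance Definition _ := isGroup.Build holomorph
  hol_mulA hol_mul1 hol_mulr1 hol_mulV hol_mulrV.

Lemma hol_autM x y : hol_aut (x * y)%g = (hol_aut x * hol_aut y)%g.
Proof. by []. Qed.

End AutomorphismGroup.

Section FirstHomology.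
Variables (R : comPzRingType) (F : groupType).

(* H_1(F; R) is computed from the bar complex: the 1-chains are the free module
   on F, all of them are cycles, and the boundary of [a|b] is [b]-[ab]+[a]. *)
Inductive H1_rel : lterm R F -> lterm R F -> Prop :=
| H1RelM a b : H1_rel (LGen R (a * b)%g) (LAdd (LGen R a) (LGen R b)).

Definition H1 : lmodType R := presented H1_rel.

Definition H1class (a : F) : H1 := pgen H1_rel a.

Lemma H1classM a b : H1class (a * b)%g = H1class a + H1class b.
Proof. by rewrite [RHS]pclassD; apply/pclassP/lcong_rel. Qed.

Lemma H1lift_rel (M : lmodType R) (f : F -> M)
    (fM : forall a b, f (a * b)%g = f a + f b) s t :
  H1_rel s t -> leval f s = leval f t.
Proof. by case=> a b; apply: fM. Qed.

Definition H1lift (M : lmodType R) (f : F -> M)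
    (fM : forall a b, f (a * b)%g = f a + f b) : {linear H1 -> M} :=
  plift (H1lift_rel fM).

Lemma H1liftE (M : lmodType R) (f : F -> M)
    (fM : forall a b, f (a * b)%g = f a + f b) a :
  H1lift fM (H1class a) = f a.
Proof. exact: pliftE. Qed.

Lemma H1_ext (M : lmodType R) (f g : {linear H1 -> M}) :
  (forall a, f (H1class a) = g (H1class a)) -> f = g.
Proof. exact: plinear_ext. Qed.

Lemma H1act_additive (phi : autgroup F) a b :
  H1class (phi (a * b)%g) = H1class (phi a) + H1class (phi b).
Proof. by rewrite aut_morph H1classM. Qed.

Definition H1act (phi : autgroup F) : {linear H1 -> H1} :=
  H1lift (H1act_additive phi).

Lemma H1actE phi a : H1act phi (H1class a) = H1class (phi a).
Proof. exact: H1liftE. Qed.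

End FirstHomology.

(* Cochains, cocycles and cohomology below depend only on the maps [act x]; that
   these form an action is a separate hypothesis. This makes the inflation of a
   tensor power of a module convertible with the tensor power of its inflation,
   while bundled modules would differ in their proof components. *)
Definition is_action (R : pzRingType) (G : groupType) (M : lmodType R)
    (act : G -> {linear M -> M}) : Prop :=
  (forall m, act 1%g m = m) /\ (forall x y m, act (x * y)%g m = act x (act y m)).

Section Cohomology.
Variables (R : pzRingType) (G : groupType) (M : lmodType R).
Variable act : G -> {linear M -> M}.

(* [face i] drops the first entry when [i = 0], the last one when [i = p + 1],
   and multiplies the [i]-th and [i+1]-st entries (counted from 1) otherwise. *)
Definition face p (i : nat) (x : 'I_p.+1 -> G) : 'I_p -> G := fun j =>
  if (j.+1 < i)%N then x (widen_ord (leqnSn p) j)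
  else if j.+1 == i then (x (widen_ord (leqnSn p) j) * x (lift ord0 j))%g
  else x (lift ord0 j).

Definition cobound p (f : ('I_p -> G) -> M) (x : 'I_p.+1 -> G) : M :=
  act (x ord0) (f (face 0 x)) + \sum_(1 <= i < p.+2) (-1) ^+ i *: f (face i x).

Definition normalized p (f : ('I_p -> G) -> M) : Prop :=
  forall x, (exists i, x i = 1%g) -> f x = 0.

Record cocycle p : Type := Cocycle {
  cocycle_fun :> ('I_p -> G) -> M;
  cocycle_normalized : normalized cocycle_fun;
  cocycle_closed : forall x, cobound cocycle_fun x = 0
}.

Definition is_coboundary p : (('I_p -> G) -> M) -> Prop :=
  if p is q.+1 return (('I_p -> G) -> M) -> Prop
  then fun f => exists2 b : ('I_q -> G) -> M,
         normalized b & forall x, f x = cobound b x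
  else fun f => forall x, f x = 0.

Lemma cobound_linear p (f g : ('I_p -> G) -> M) (a : R) x :
  (forall k (m : M), (-1) ^+ k *: (a *: m) = a *: ((-1) ^+ k *: m)) ->
  cobound (fun y => a *: f y + g y) x = a *: cobound f x + cobound g x.
Proof.
move=> aC; rewrite /cobound linearP scalerDr scaler_sumr addrACA -big_split /=.
by congr (_ + _); apply: eq_bigr => i _; rewrite scalerDr aC.
Qed.

Lemma is_coboundary_ext p (f g : ('I_p -> G) -> M) :
  f =1 g -> is_coboundary f -> is_coboundary g.
Proof. by move=> /funext ->. Qed.

Lemma is_coboundary0 p : is_coboundary (fun _ : 'I_p -> G => 0).
Proof.
case: p => [|p] //=; exists (fun=> 0) => // x.
by rewrite /cobound linear0 add0r big1 // => i _; rewrite scaler0.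
Qed.

Lemma is_coboundaryD p (f g : ('I_p -> G) -> M) :
  is_coboundary f -> is_coboundary g -> is_coboundary (fun x => f x + g x).
Proof.
case: p f g => [|p] f g /=; first by move=> f0 g0 x; rewrite f0 g0 addr0.
move=> [b bN bE] [c cN cE]; exists (fun x => 1 *: b x + c x).
  by move=> x xi; rewrite bN // cN // scaler0 addr0.
by move=> x; rewrite cobound_linear ?scale1r ?bE ?cE// => k m; rewrite !scale1r.
Qed.

Lemma is_coboundaryN p (f : ('I_p -> G) -> M) :
  is_coboundary f -> is_coboundary (fun x => - f x).
Proof.
case: p f => [|p] f /=; first by move=> f0 x; rewrite f0 oppr0.
move=> [b bN bE]; exists (fun x => -1 *: b x + 0).
  by move=> x xi; rewrite bN // scaler0 addr0.
move=> x; rewrite cobound_linear => [|k m]; last first.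
  by rewrite !scalerA mulrN1 mulN1r.
have -> : cobound (fun=> 0) x = 0.
  by rewrite /cobound linear0 add0r big1 // => i _; rewrite scaler0.
by rewrite scaleN1r addr0 bE.
Qed.

Section Quotient.
Variable p : nat.

HB.instance Definition _ := gen_eqMixin (cocycle p).
HB.instance Definition _ := gen_choiceMixin (cocycle p).

Definition cohomologous (f g : cocycle p) : bool :=
  `[< is_coboundary (fun x => f x - g x) >].

Lemma cohomologous_refl : reflexive cohomologous.
Proof.
move=> f; apply/asboolP; apply: is_coboundary_ext (is_coboundary0 p) => x.
by rewrite subrr.
Qed.
Lemma cohomologous_sym : symmetric cohomologous.
Proof.
suff s f g : cohomologous f g -> cohomologous g f.
  by move=> f g; apply/idP/idP; apply: s.
move=> /asboolP/is_coboundaryN fg; apply/asboolP.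
by apply: is_coboundary_ext fg => x; rewrite opprB.
Qed.
Lemma cohomologous_trans : transitive cohomologous.
Proof.
move=> g f h /asboolP fg /asboolP gh; apply/asboolP.
by apply: is_coboundary_ext (is_coboundaryD fg gh) => x; rewrite addrA subrK.
Qed.
Canonical cohomologous_equiv := EquivRel cohomologous
  cohomologous_refl cohomologous_sym cohomologous_trans.

Definition cohomology := {eq_quot cohomologous_equiv}%qT.
HB.instance Definition _ := Choice.on cohomology.
HB.instance Definition _ := EqQuotient.on cohomology.

Definition cohclass (f : cocycle p) : cohomology := (\pi_cohomology f)%qT.

Lemma cohclassP f g :
  cohclass f = cohclass g <-> is_coboundary (fun x => f x - g x).
Proof.
rewrite /cohclass; split=> [/eqmodP /asboolP //|fg]; apply/eqmodP.
exact/asboolP.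
Qed.

Lemma cohclass_repr (c : cohomology) : cohclass (repr c) = c.
Proof. exact: reprK. Qed.

Lemma cocycle0_closed x : cobound (fun _ : 'I_p -> G => 0) x = 0.
Proof.
by rewrite /cobound linear0 add0r big1 // => i _; rewrite scaler0.
Qed.

Definition cocycle0 : cocycle p :=
  @Cocycle p (fun=> 0) (fun _ _ => erefl) cocycle0_closed.

End Quotient.

Section OneCocycle.
Variable f : G -> M.
Hypothesis actP : is_action act.
Hypothesis fM : forall x y, f (x * y)%g = f x + act x (f y).

Lemma cocycle1_normalized :
  @normalized 1 (fun x => f (x ord0)).
Proof.
move=> x [i]; rewrite (ord1 i) => ->.
have := fM 1%g 1%g; rewrite mulg1 (actP.1 (f 1%g)) -[LHS]addr0.
by move/addrI => <-.
Qed.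

Lemma cocycle1_closed x : @cobound 1 (fun x => f (x ord0)) x = 0.
Proof.
rewrite /cobound big_ltn // big_nat1 /face /= !expr1 sqrrN expr1n scaleN1r scale1r.
have -> : widen_ord (leqnSn 1) ord0 = ord0 by apply: val_inj.
by rewrite fM [f _ + act _ _]addrC opprD -addrA addNr addr0 subrr.
Qed.

Definition cocycle1 : cocycle 1 := Cocycle cocycle1_normalized cocycle1_closed.

End OneCocycle.

End Cohomology.

Section CohomologyMap.
Variables (R : pzRingType) (G : groupType) (M N : lmodType R).
Variables (actM : G -> {linear M -> M}) (actN : G -> {linear N -> N}).
Variable u : {linear M -> N}.
Hypothesis uP : forall x m, u (actM x m) = actN x (u m).

Lemma cobound_map p (f : ('I_p -> G) -> M) x :
  cobound actN (fun y => u (f y)) x = u (cobound actM f x).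
Proof.
rewrite /cobound linearD uP linear_sum; congr (_ + _).
by apply: eq_bigr => i _; rewrite linearZZ.
Qed.

Lemma cocycle_map_normalized p (f : cocycle actM p) :
  normalized (fun x => u (f x)).
Proof. by move=> x xi; rewrite cocycle_normalized // linear0. Qed.

Lemma cocycle_map_closed p (f : cocycle actM p) x :
  cobound actN (fun y => u (f y)) x = 0.
Proof. by rewrite cobound_map cocycle_closed linear0. Qed.

Definition cocycle_map p (f : cocycle actM p) : cocycle actN p :=
  Cocycle (cocycle_map_normalized f) (cocycle_map_closed f).

Definition coh_map p (c : cohomology actM p) : cohomology actN p :=
  cohclass (cocycle_map (repr c)).

Lemma coh_mapE p (f : cocycle actM p) :
  coh_map (cohclass f) = cohclass (cocycle_map f).
Proof.
have /cohclassP := cohclass_repr (cohclass f).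
set g := repr _ => gf; apply/cohclassP => /=.
have ue x : u (g x - f x) = u (g x) - u (f x) by rewrite linearB.
apply: (is_coboundary_ext ue).
case: p f g {ue} gf => [|p] f g /=; first by move=> gf x; rewrite gf linear0.
move=> [b bN bE]; exists (fun y => u (b y)).
  by move=> x xi; rewrite bN // linear0.
by move=> x; rewrite bE cobound_map.
Qed.

End CohomologyMap.

Section CupProduct.
Variables (R : comPzRingType) (G : groupType).

Definition cup (M N : lmodType R) (actN : G -> {linear N -> N}) p q
    (f : ('I_p -> G) -> M) (g : ('I_q -> G) -> N)
    (x : 'I_(p + q) -> G) : tensor M N :=
  tens (f (fun i => x (lshift q i)))
       (actN (\big[*%g/1%g]_(i < p) x (lshift q i))
             (g (fun j => x (rshift p j)))).

Section Power.
Variables (M : lmodType R) (act : G -> {linear M -> M}).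

Definition tpow_act p (x : G) : {linear tpow M p -> tpow M p} :=
  tpow_map (act x) p.

(* f^{(x) p} = f u (f u (... (f u 1))), for the bracketing of [tpow]. *)
Fixpoint cup_pow (f : ('I_1 -> G) -> M) p : ('I_p -> G) -> tpow M p :=
  if p is q.+1
  then cup (tpow_act q) f (@cup_pow f q) : ('I_q.+1 -> G) -> tpow M q.+1
  else fun=> tunit M.
Arguments cup_pow f p x : clear implicits.

Hypothesis actP : is_action act.
Variable f : cocycle act 1.

Lemma tpow_act_action p : is_action (tpow_act p).
Proof.
case: actP => act1 actM; split=> [m|x y m].
  exact: tpow_map_id.
rewrite /tpow_act.
have -> : act (x * y)%g = act x \o act y by apply: linear_ext => z; rewrite actM.
exact: tpow_map_comp.
Qed.

Lemma cup_pow_normalized p : normalized (cup_pow f p).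
Proof.
elim: p => [|p IHp] x [i xi]; first by case: i xi.
rewrite /= /cup; have [j e|j e] := split_ordP (i : 'I_(1 + p)).
  rewrite [f _]cocycle_normalized ?tens0l //.
  by exists j; rewrite -e.
rewrite [cup_pow f p _]IHp ?linear0 ?tens0r //.
by exists j; rewrite -e.
Qed.

Lemma cup_pow_closed p x : cobound (tpow_act p) (cup_pow f p) x = 0.
Proof.
elim: p x => [|p IHp] x.
  by rewrite /cobound big_nat1 expr1 scaleN1r addrN.
pose a := x ord0; pose x' (j : 'I_p.+1) := x (lift ord0 j); pose b := x' ord0.
pose F c := f (fun=> c).
have FM : F (a * b)%g = F a + act a (F b).
  have := cocycle_closed f (fun j : 'I_2 => if j == ord0 then a else b).
  rewrite /cobound big_ltn // big_nat1 /= !expr1 sqrrN expr1n scaleN1r scale1r.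
  have -> : face 0 (fun j : 'I_2 => if j == ord0 then a else b) = fun=> b.
    by apply: funext => j; rewrite (ord1 j).
  have -> : face 1 (fun j : 'I_2 => if j == ord0 then a else b) = fun=> (a * b)%g.
    by apply: funext => j; rewrite (ord1 j).
  have -> : face 2 (fun j : 'I_2 => if j == ord0 then a else b) = fun=> a.
    by apply: funext => j; rewrite (ord1 j).
  by rewrite -/(F _) addrA => /eqP; rewrite addrAC subr_eq0 addrC => /eqP ->.
have cupE y : cup_pow f p.+1 y =
    tens (F (y ord0)) (tpow_act p (y ord0) (cup_pow f p (fun j => y (lift ord0 j)))).
  rewrite /= /cup big_ord1; congr (tens (f _) (tpow_act p _ (cup_pow f p _))).
  - by apply: funext => j; rewrite (ord1 j); congr y; apply: val_inj.
  - by congr y; apply: val_inj.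
  - by apply: funext => j; congr y; apply: val_inj.
have tactM : forall z w m, tpow_act p (z * w)%g m = tpow_act p z (tpow_act p w m).
  exact: (tpow_act_action p).2.
rewrite /cobound big_ltn // big_add1 [p.+3.-1]/= expr1 scaleN1r.
have e0 : cup_pow f p.+1 (face 0 x) =
    tens (F b) (tpow_act p b (cup_pow f p (face 0 x'))).
  by rewrite cupE.
have e1 : cup_pow f p.+1 (face 1 x) =
    tens (F (a * b)%g) (tpow_act p (a * b)%g (cup_pow f p (face 0 x'))).
  rewrite cupE; have -> : face 1 x ord0 = (a * b)%g.
    by rewrite /face /=; congr (x _ * _)%g; apply: val_inj.
  by congr (tens _ (tpow_act p _ (cup_pow f p _))); apply: funext => j.
have ei i : (0 < i)%N -> cup_pow f p.+1 (face i.+1 x) =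
    tens (F a) (tpow_act p a (cup_pow f p (face i x'))).
  move=> i0; rewrite cupE; have -> : face i.+1 x ord0 = a.
    by rewrite /face /= ltnS i0; congr x; apply: val_inj.
  congr (tens _ (tpow_act p _ (cup_pow f p _))); apply: funext => j.
  rewrite /face /= /bump /= add1n !ltnS eqSS.
  have -> : widen_ord (leqnSn p.+1) (lift ord0 j) =
            lift ord0 (widen_ord (leqnSn p) j) by apply: val_inj.
  by [].
pose Y := tpow_act p b (cup_pow f p (face 0 x')).
have e0' : tpow_act p.+1 a (cup_pow f p.+1 (face 0 x)) =
    tens (act a (F b)) (tpow_act p a Y).
  by rewrite e0; apply: tpow_mapS.
have e1' : cup_pow f p.+1 (face 1 x) = tens (F (a * b)%g) (tpow_act p a Y).
  by rewrite e1 tactM.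
have -> : \sum_(1 <= i < p.+2) (-1) ^+ i.+1 *: cup_pow f p.+1 (face i.+1 x) =
    - tens (F a) (tpow_act p a (\sum_(1 <= i < p.+2)
        (-1) ^+ i *: cup_pow f p (face i x'))).
  pose tF := mklin ((tens_bilinear M (tpow M p)).2 (F a)).
  rewrite linear_sum -[tens (F a) _]/(tF _) linear_sum -sumrN.
  apply: eq_big_nat => i /andP[i0 _].
  rewrite ei // [tpow_act p a (_ *: _)]linearZZ [tF _]linearZZ exprS mulN1r.
  exact: scaleNr.
have -> : \sum_(1 <= i < p.+2) (-1) ^+ i *: cup_pow f p (face i x') = - Y.
  by have /eqP := IHp x'; rewrite /cobound addrC addr_eq0 => /eqP.
rewrite e0' e1' [tpow_act p a (- Y)]linearN tensNr opprK FM tensDl.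
rewrite [tens (F a) _ + _]addrC opprD -addrA addNr addr0.
exact: subrr.
Qed.

Definition cocycle_pow p : cocycle (tpow_act p) p :=
  Cocycle (@cup_pow_normalized p) (@cup_pow_closed p).

End Power.
End CupProduct.

Section HomAction.
Variables (R : comPzRingType) (G : groupType) (U V : lmodType R).
Variables (actU : G -> {linear U -> U}) (actV : G -> {linear V -> V}).

Lemma hom_act_linear x :
  linear (fun u : {linear U -> V} =>
    (actV x \o u \o actU x^-1%g : {linear U -> V})).
Proof.
move=> a u v; apply: linear_ext => m.
by rewrite [RHS]lhomDE lhomZE !lcompE lhomDE lhomZE linearP.
Qed.

Definition hom_act (x : G) : {linear {linear U -> V} -> {linear U -> V}} :=
  mklin (hom_act_linear x).

Lemma hom_actE x u m : hom_act x u m = actV x (u (actU x^-1%g m)).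
Proof. by []. Qed.

Lemma hom_act_action : is_action actU -> is_action actV -> is_action hom_act.
Proof.
move=> [U1 UM] [V1 VM]; split=> [u|x y u]; apply: linear_ext => m.
  by rewrite hom_actE invg1 U1 V1.
by rewrite !hom_actE invgM UM VM.
Qed.

End HomAction.

Lemma H1act_action (R : comPzRingType) (F : groupType) :
  is_action (@H1act R F).
Proof.
split=> [m|x y m].
  suff -> : H1act R 1%g = (idfun : {linear H1 R F -> H1 R F}) by [].
  by apply: H1_ext => a; rewrite H1actE.
suff -> : H1act R (x * y)%g =
    (H1act R x \o H1act R y : {linear H1 R F -> H1 R F}) by [].
by apply: H1_ext => a; rewrite lcompE !H1actE.
Qed.

Section Gysin.
Variables (R : comPzRingType) (F : groupType) (M : lmodType R).
Variable act : autgroup F -> {linear M -> M}.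

(* M with the action of the holomorph through its projection to Aut F; the
   subgroup F, which is the kernel of the projection, acts trivially. *)
Definition inflate (x : holomorph F) : {linear M -> M} := act (hol_aut x).

Lemma inflate_action : is_action act -> is_action inflate.
Proof. by case=> act1 actM; split=> [m|x y m]; [exact: act1|exact: actM]. Qed.

Definition filtered p (f : ('I_p -> holomorph F) -> M) : Prop :=
  forall x i j, i != j -> hol_aut (x i) = 1%g -> hol_aut (x j) = 1%g -> f x = 0.

(* (phi_1, ..., phi_i, (phi_1 ... phi_i)^-1(a), phi_{i+1}, ..., phi_p) *)
Definition shuffle p (phi : 'I_p -> autgroup F) (a : F) (i : 'I_p.+1) :
    'I_p.+1 -> holomorph F := fun j =>
  if unlift i j is Some k then Holo 1%g (phi k)
  else Holo ((\big[*%g/1%g]_(k < p | (k < i)%N) phi k)^-1%g a) 1%g.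

(* The edge map through its Hochschild-Serre description: [f] is a normalized
   cocycle representing [c] that vanishes when two of its arguments lie in the
   subgroup F, and [g] is the resulting cocycle with values in
   H^1(F; M) = Hom(H, M). *)
Definition gysin_graph p (c : cohomology inflate p.+1)
    (d : cohomology (hom_act (@H1act R F) act) p) : Prop :=
  exists (f : cocycle inflate p.+1) (g : cocycle (hom_act (@H1act R F) act) p),
    [/\ cohclass f = c, filtered f, cohclass g = d &
        forall phi a, g phi (H1class R a) =
          \sum_(i < p.+1) (-1) ^+ i *: f (shuffle phi a i)].

(* For F free and [act] an action, [gysin_graph] is the graph of a total function
   by the Hochschild-Serre theorem, so the choice made by [xget] is forced and
   its default value is never used. *)
Definition gysin p (c : cohomology inflate p.+1) :
    cohomology (hom_act (@H1act R F) act) p :=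
  xget (cohclass (cocycle0 _ p)) [set d | gysin_graph c d]%classic.

End Gysin.

Section HClass.
Variables (R : comPzRingType) (F : groupType).
Local Notation H := (H1 R F).

Definition k0 (x : holomorph F) : H := H1class R (hol_el x).

Lemma k0M x y : k0 (x * y)%g = k0 x + inflate (@H1act R F) x (k0 y).
Proof. by rewrite /k0 H1classM /inflate H1actE. Qed.

Definition k0_cocycle : cocycle (inflate (@H1act R F)) 1 :=
  cocycle1 (inflate_action (@H1act_action R F)) k0M.

Definition target_act m :
    autgroup F -> {linear {linear H -> tpow H m} -> {linear H -> tpow H m}} :=
  hom_act (@H1act R F) (tpow_act (@H1act R F) m).

Definition hclass p : cohomology (target_act p.+1) p :=
  gysin (cohclass (cocycle_pow (inflate_action (@H1act_action R F)) k0_cocycle p.+1)).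

End HClass.

Section Magnus.
Variables (R : comPzRingType) (F : groupType).
Local Notation H := (H1 R F).

(* An element is the family of its homogeneous components. *)
Definition ctensor : Type := forall m, tpow H m.

Definition ctensor_mul (s t : ctensor) : ctensor := fun m =>
  \sum_(i < m.+1) tcast (subnKC (leq_ord i)) (tcat (s i) (t (m - i)%N)).

(* The first two conditions say theta(a) = 1 + [a] modulo degree >= 2. *)
Definition magnus_expansion (theta : F -> ctensor) : Prop :=
  [/\ forall a, theta a 0 = tunit H,
      forall a, theta a 1 = tdeg1 (H1class R a) &
      forall a b, theta (a * b)%g = ctensor_mul (theta a) (theta b)].

Variable theta : F -> ctensor.
Hypothesis thetaP : magnus_expansion theta.

Lemma magnus2M a b :
  theta (a * b)%g 2 =
    theta a 2 + theta b 2 + tens (H1class R a) (tdeg1 (H1class R b)).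
Proof.
have [t0 t1 tM] := thetaP.
have castE i (e : i = i) (t : tpow H i) : tcast e t = t.
  by rewrite (eq_irrelevance e erefl).
rewrite tM /ctensor_mul !big_ord_recl big_ord0 addr0.
rewrite [X in X + _](_ : _ = theta b 2); last first.
  by rewrite [LHS]castE t0 [LHS]tcat0 scale1r.
rewrite [X in _ + (X + _)](_ : _ = tens (H1class R a) (tdeg1 (H1class R b))).
  rewrite [X in _ + (_ + X)](_ : _ = theta a 2); last first.
    by rewrite [LHS]castE [theta b _]t0; apply: tcat_unit2.
  by rewrite addrC -addrA addrC -addrA addrC addrAC.
rewrite [LHS]castE [theta a _]t1 [theta b _]t1 [LHS]tcatS; congr tens.
by rewrite [LHS]tcat0 scale1r.
Qed.

Lemma johnson_additive (phi : autgroup F) a b :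
  theta (a * b)%g 2 -
    tpow_map (H1act R phi) 2 (theta (phi^-1%g (a * b)%g) 2) =
  (theta a 2 - tpow_map (H1act R phi) 2 (theta (phi^-1%g a) 2)) +
  (theta b 2 - tpow_map (H1act R phi) 2 (theta (phi^-1%g b) 2)).
Proof.
have e : tpow_map (H1act R phi) 2
    (tens (H1class R (phi^-1%g a)) (tdeg1 (H1class R (phi^-1%g b)))) =
    tens (H1class R a) (tdeg1 (H1class R b)).
  rewrite tpow_mapS H1actE autVK; congr tens.
  by rewrite [LHS]tpow_mapS H1actE autVK.
rewrite aut_morph !magnus2M.
rewrite [tpow_map _ _ _]linearD [tpow_map _ _ (_ + _)]linearD e.
set C := tens _ _; rewrite opprD addrACA subrr addr0 opprD.
exact: addrACA.
Qed.

Definition johnson (phi : autgroup F) : {linear H -> tpow H 2} :=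
  H1lift (johnson_additive phi).

Lemma johnsonE phi a :
  johnson phi (H1class R a) =
    theta a 2 - tpow_map (H1act R phi) 2 (theta (phi^-1%g a) 2).
Proof. exact: H1liftE. Qed.

Lemma johnsonM phi psi :
  johnson (phi * psi)%g = johnson phi + target_act R 2 phi (johnson psi).
Proof.
apply: H1_ext => a; rewrite lhomDE [target_act _ _ _ _ _]hom_actE H1actE.
rewrite !johnsonE linearB addrA subrK; congr (_ - _).
rewrite [RHS](esym ((tpow_act_action (@H1act_action R F) 2).2 _ _ _)).
by rewrite invgM.
Qed.

Lemma target_act_action m : is_action (@target_act R F m).
Proof.
exact: hom_act_action (@H1act_action R F) (tpow_act_action (@H1act_action R F) m).
Qed.

Definition johnson_cocycle : cocycle (@target_act R F 2) 1 :=
  cocycle1 (target_act_action 2) johnsonM.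

End Magnus.

Section VarsigmaStar.
Variables (R : comPzRingType) (F : groupType).
Local Notation H := (H1 R F).

Lemma varsigma_equivariant p x w :
  varsigma H p (tpow_act (@target_act R F 2) p x w) =
    target_act R p.+1 x (varsigma H p w).
Proof.
have HVK m : H1act R x (H1act R x^-1%g m) = m.
  by rewrite -(@H1act_action R F).2 mulgV (@H1act_action R F).1.
elim: p w => [|p IHp] w.
  have E v : tpow_act (@H1act R F) 1 x (tdeg1 v) = tdeg1 (H1act R x v).
    exact: tpow_mapS.
  apply: H1_ext => a; rewrite [RHS]hom_actE !varsigma0E linearZZ E HVK.
  by [].
have idr_equivariant u t :
    tens_idr (target_act R 2 x u) p (tpow_act (@H1act R F) p.+1 x t) =
    tpow_act (@H1act R F) p.+2 x (tens_idr u p t).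
  suff e : (tens_idr (target_act R 2 x u) p \o tpow_act (@H1act R F) p.+1 x
           : {linear tpow H p.+1 -> tpow H p.+2}) =
           tpow_act (@H1act R F) p.+2 x \o tens_idr u p.
    by rewrite -[LHS]lcompE e.
  apply: tensor_ext => v s; rewrite !lcompE.
  rewrite (_ : tpow_act _ p.+1 x (tens v s) =
    tens (H1act R x v) (tpow_act (@H1act R F) p x s)); last exact: tpow_mapS.
  rewrite !tens_idrE [target_act _ _ _ _ _]hom_actE.
  rewrite -(@H1act_action R F).2 mulVg (@H1act_action R F).1.
  exact: (esym (tpow_map_cat (H1act R x) (u v) s)).
pose lhs := (varsigma H p.+1 \o tpow_act (@target_act R F 2) p.+1 x
  : {linear tpow {linear H -> tpow H 2} p.+1 -> {linear H -> tpow H p.+2}}).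
pose rhs := (target_act R p.+2 x \o varsigma H p.+1
  : {linear tpow {linear H -> tpow H 2} p.+1 -> {linear H -> tpow H p.+2}}).
suff e : lhs = rhs by exact: (congr1 (fun h : {linear _ -> _} => h w) e).
apply: tensor_ext => u t; rewrite [lhs _]lcompE [rhs _]lcompE.
rewrite (_ : tpow_act _ p.+1 x (tens u t) = tens (target_act R 2 x u)
  (tpow_act (@target_act R F 2) p x t)); last exact: tpow_mapS.
rewrite !varsigmaSE IHp; apply: linear_ext => h.
rewrite lcompE [target_act _ _ _ _ _ in LHS]hom_actE idr_equivariant.
by rewrite [RHS]hom_actE lcompE.
Qed.

Definition varsigma_star p :
    cohomology (tpow_act (@target_act R F 2) p) p ->
    cohomology (@target_act R F p.+1) p :=
  coh_map (@varsigma_equivariant p) (p := p).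

End VarsigmaStar.

(* Main.v *)
Require Import Defs.
From HB Require Import structures.
From mathcomp Require Import all_boot all_algebra.
From mathcomp Require Import boolp classical_sets functions.

Set Implicit Arguments.
Unset Strict Implicit.
Unset Printing Implicit Defensive.

Import GRing.Theory.
Local Open Scope ring_scope.

(* Write G for the holomorph of F. The coboundary of theta_2, extended to G by
   the F-coordinate, shows that k0 cup k0 is cohomologous to
   (x, y) |-> - tau(x)(x k0(y)). Substituting this repeatedly into the first two
   factors, k0^(p+1) becomes cohomologous to (-1)^p varsigma_p(tau^p) applied to
   the last k0. This cocycle is filtered, and in its Gysin sum only the term
   with the element of F in the last place survives.

   That the Gysin sum of a filtered cocycle depends only on its class up to
   coboundaries uses the freeness of F. Modulo constants, maps from F to M form a
   G-module Q with Q^F = Hom(F, M), and Gysin sums are, up to inflation, cocycles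
   with values in Q. As F is free, H^1(F; Q) = H^2(F; M) = 0, and likewise for the
   modules that arise by dimension shifting, so the inflation
   H^p(Aut F; Q^F) -> H^p(G; Q) is injective. *)

(** * Cochains by head and tail, and the coboundary as a recursion on the degree *)

Section ConsTail.
Variable G : Type.

Definition fcons n (a : G) (x : 'I_n -> G) : 'I_n.+1 -> G :=
  fun i => if unlift ord0 i is Some j then x j else a.

Definition ftail n (x : 'I_n.+1 -> G) : 'I_n -> G := fun j => x (lift ord0 j).

Lemma fcons0 n a (x : 'I_n -> G) : fcons a x ord0 = a.
Proof. by rewrite /fcons unlift_none. Qed.

Lemma fcons_lift n a (x : 'I_n -> G) j : fcons a x (lift ord0 j) = x j.
Proof. by rewrite /fcons liftK. Qed.

Lemma ftail_fcons n a (x : 'I_n -> G) : ftail (fcons a x) = x.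
Proof. by apply: funext => j; apply: fcons_lift. Qed.

Lemma fcons_eta n (x : 'I_n.+1 -> G) : fcons (x ord0) (ftail x) = x.
Proof.
by apply: funext => i; case: (unliftP ord0 i) => [j|] ->;
  rewrite ?fcons0 ?fcons_lift.
Qed.

Lemma fnil_eq (x y : 'I_0 -> G) : x = y.
Proof. by apply: funext => -[]. Qed.

End ConsTail.

Definition fconsE := (fcons0, ftail_fcons).

Section Faces.
Variable G : groupType.

(* The part of the coboundary made of the faces of positive index, in a form
   suited to induction on the degree; it does not involve the action. *)
Fixpoint dface (V : zmodType) n :
    (('I_n -> G) -> V) -> ('I_n.+1 -> G) -> V :=
  if n is n'.+1 return (('I_n -> G) -> V) -> ('I_n.+1 -> G) -> V then
    fun f x => - f (fcons (x ord0 * ftail x ord0)%g (ftail (ftail x)))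
               - dface (fun y => f (fcons (x ord0) y)) (ftail x)
  else fun f x => - f (ftail x).

Lemma dfaceS (V : zmodType) n (f : ('I_n.+1 -> G) -> V) a b x :
  dface f (fcons a (fcons b x)) =
  - f (fcons (a * b)%g x) - dface (fun y => f (fcons a y)) (fcons b x).
Proof. by rewrite /= !fconsE. Qed.

Lemma dface0 (V : zmodType) (f : ('I_0 -> G) -> V) x : dface f x = - f (ftail x).
Proof. by []. Qed.

Lemma dface_map (V W : zmodType) (u : {additive V -> W}) n
    (f : ('I_n -> G) -> V) x :
  dface (fun y => u (f y)) x = u (dface f x).
Proof.
elim: n f x => [|n IHn] f x /=; first by rewrite raddfN.
by rewrite raddfB raddfN IHn.
Qed.

Lemma dfaceB (V : zmodType) n (f g : ('I_n -> G) -> V) x :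
  dface (fun y => f y - g y) x = dface f x - dface g x.
Proof.
elim: n f g x => [|n IHn] f g x /=; first by rewrite opprB opprK addrC.
by rewrite IHn !opprD !opprK addrACA.
Qed.

Lemma dface_0 (V : zmodType) n x : dface (fun _ : 'I_n -> G => 0 : V) x = 0.
Proof.
elim: n x => [|n IHn] x /=; first by rewrite oppr0.
by rewrite IHn subr0 oppr0.
Qed.

Lemma dfaceN (V : zmodType) n (f : ('I_n -> G) -> V) x :
  dface (fun y => - f y) x = - dface f x.
Proof.
rewrite -[RHS]sub0r -[0 in RHS](dface_0 _ x) -dfaceB.
by congr (dface _ x); apply: funext => y; rewrite sub0r.
Qed.

Lemma dfaceD (V : zmodType) n (f g : ('I_n -> G) -> V) x :
  dface (fun y => f y + g y) x = dface f x + dface g x.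
Proof.
rewrite -[dface g x]opprK -dfaceN -dfaceB.
by congr (dface _ x); apply: funext => y; rewrite opprK.
Qed.

(** Both copies of [dface] split off the face that merges the first two arguments. The iterated
    merges agree by associativity, and what remains is the same identity for [f] with its first
    argument fixed. *)
Lemma dface_dface (V : zmodType) n (f : ('I_n -> G) -> V) x :
  dface (dface f) x = 0.
Proof.
rewrite -(fcons_eta x) -(fcons_eta (ftail x)).
move: (x ord0) (ftail x ord0) (ftail (ftail x)) => a b {}x.
elim: n f a b x => [|n IHn] f a b x.
  by rewrite dfaceS !dface0 !fconsE opprK subrr.
rewrite -(fcons_eta x); move: (x ord0) (ftail x) => c {}x.
rewrite dfaceS [dface f (fcons (a * b)%g _)]dfaceS.
have -> : dface (fun y => dface f (fcons a y)) (fcons b (fcons c x)) =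
    dface (fun z => - f (fcons (a * z ord0)%g (ftail z))
         - dface (fun y => f (fcons a y)) z) (fcons b (fcons c x)).
  congr (dface _ _); apply: funext => z; rewrite -[in LHS](fcons_eta z).
  by rewrite dfaceS fcons_eta.
rewrite dfaceB IHn subr0 dfaceN dfaceS !fconsE mulgA.
rewrite !opprD !opprK.
rewrite [X in _ + (- _ - dface X _)](_ : _ = fun y => f (fcons (a * b)%g y)).
  by rewrite addrACA !subrr addr0.
by apply: funext => y; rewrite !fconsE.
Qed.

Variables (R : pzRingType) (M : lmodType R) (act : G -> {linear M -> M}).

Lemma coboundE n (f : ('I_n -> G) -> M) x :
  cobound act f x = act (x ord0) (f (ftail x)) + dface f x.
Proof.
rewrite /cobound; congr (act _ (f _) + _).
have face1 m (y : 'I_m.+2 -> G) :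
    face 1 y = fcons (y ord0 * ftail y ord0)%g (ftail (ftail y)).
  apply: funext => i; rewrite /face; case: (unliftP ord0 i) => [j|] ->.
    by rewrite fcons_lift.
  by rewrite fcons0 /=; congr (y _ * _)%g; apply: val_inj.
have faceS m i (y : 'I_m.+2 -> G) : (0 < i)%N ->
    face i.+1 y = fcons (y ord0) (face i (ftail y)).
  move=> i0; apply: funext => k; rewrite /face; case: (unliftP ord0 k) => [j|] ->.
    rewrite fcons_lift /= /bump /= add1n !ltnS eqSS.
    suff -> : widen_ord (leqnSn m.+1) (lift ord0 j) =
      lift ord0 (widen_ord (leqnSn m) j) by [].
    exact: val_inj.
  by rewrite fcons0 /= ltnS i0; congr y; apply: val_inj.
elim: n f x => [|n IHn] f x.
  rewrite big_nat1 expr1 scaleN1r /=; congr (- f _); exact: fnil_eq.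
rewrite big_ltn // big_add1 /= expr1 scaleN1r face1; congr (_ + _).
rewrite -IHn -sumrN; apply: eq_big_nat => i /andP[i0 _].
by rewrite faceS // exprS mulN1r scaleNr.
Qed.

Lemma cobound_fcons n (f : ('I_n -> G) -> M) a x :
  cobound act f (fcons a x) = act a (f x) + dface f (fcons a x).
Proof. by rewrite coboundE !fconsE. Qed.

Lemma coboundB n (f g : ('I_n -> G) -> M) x :
  cobound act (fun y => f y - g y) x = cobound act f x - cobound act g x.
Proof. by rewrite !coboundE linearB dfaceB opprD addrACA. Qed.

Lemma coboundN n (f : ('I_n -> G) -> M) x :
  cobound act (fun y => - f y) x = - cobound act f x.
Proof. by rewrite !coboundE linearN dfaceN opprD. Qed.

Lemma fcons_normalized n (f : ('I_n.+1 -> G) -> M) a :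
  normalized f -> normalized (fun y => f (fcons a y)).
Proof.
by move=> fN y [i yi]; apply: fN; exists (lift ord0 i); rewrite fcons_lift.
Qed.

Lemma dface_fcons1 n (f : ('I_n -> G) -> M) x :
  normalized f -> dface f (fcons 1%g x) = - f x.
Proof.
case: n f x => [|n] f x fN; first by rewrite dface0 ftail_fcons.
rewrite -(fcons_eta x) dfaceS mul1g [X in dface X](_ : _ = fun=> 0).
  by rewrite dface_0 subr0.
by apply: funext => y; apply: fN; exists ord0; rewrite fcons0.
Qed.

Lemma dface_normalized n (f : ('I_n -> G) -> M) x j :
  normalized f -> x (lift ord0 j) = 1%g -> dface f x = 0.
Proof.
elim: n f x j => [|n IHn] f x j fN; first by case: j.
rewrite -(fcons_eta x) -(fcons_eta (ftail x)) fcons_lift.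
move: (x ord0) (ftail x ord0) (ftail (ftail x)) => a b {}x.
case: (unliftP ord0 j) => [k|] ->; rewrite ?fcons_lift ?fcons0 => e.
  rewrite dfaceS (IHn _ _ k (fcons_normalized a fN)) ?fcons_lift //.
  rewrite fN ?oppr0 ?addr0 //.
  by exists (lift ord0 k); rewrite fcons_lift.
rewrite dfaceS e mulg1 (dface_fcons1 _ (fcons_normalized a fN)) opprK.
exact: addNr.
Qed.

Lemma cobound_normalized n (f : ('I_n -> G) -> M) :
  is_action act -> normalized f -> normalized (cobound act f).
Proof.
move=> [act1 _] fN x [i]; rewrite -(fcons_eta x).
move: (x ord0) (ftail x) => a {}x; case: (unliftP ord0 i) => [j|] ->.
  rewrite fcons_lift => xj; rewrite cobound_fcons (@dface_normalized _ _ _ j) //.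
    by rewrite fN ?linear0 ?addr0 //; exists j.
  by rewrite fcons_lift.
by rewrite fcons0 => ->; rewrite cobound_fcons act1 dface_fcons1 ?subrr.
Qed.

Lemma cobound_cobound n (f : ('I_n -> G) -> M) x : is_action act ->
  cobound act (cobound act f) x = 0.
Proof.
move=> [_ actM]; rewrite -(fcons_eta x) -(fcons_eta (ftail x)).
move: (x ord0) (ftail x ord0) (ftail (ftail x)) => a b {}x.
rewrite cobound_fcons.
have -> : cobound act f = fun z => act (z ord0) (f (ftail z)) + dface f z.
  by apply: funext => z; rewrite coboundE.
rewrite dfaceD dface_dface addr0 dfaceS !fconsE linearD actM.
have -> : dface (fun y => act (fcons a y ord0) (f (ftail (fcons a y)))) (fcons b x)
    = act a (dface f (fcons b x)).
  rewrite -dface_map; congr (dface _ _); apply: funext => y; by rewrite !fconsE.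
by rewrite addrACA !subrr addr0.
Qed.

End Faces.

Lemma fcons_comp (A B : Type) (s : A -> B) n a (x : 'I_n -> A) :
  s \o fcons a x = fcons (s a) (s \o x).
Proof.
by apply: funext => i; case: (unliftP ord0 i) => [j|] ->;
  rewrite /= ?fcons0 ?fcons_lift.
Qed.

Lemma dface_comp (G K : groupType) (s : G -> K) (V : zmodType) n
    (f : ('I_n -> K) -> V) x : {morph s : a b / (a * b)%g} ->
  dface (fun y => f (s \o y)) x = dface f (s \o x).
Proof.
move=> sM; elim: n f x => [|n IHn] f x //.
rewrite -(fcons_eta x) -(fcons_eta (ftail x)).
move: (x ord0) (ftail x ord0) (ftail (ftail x)) => a b {}x.
rewrite !fcons_comp !dfaceS fcons_comp sM -[in RHS]fcons_comp -IHn.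
congr (_ - dface _ _); apply: funext => y; by rewrite fcons_comp.
Qed.

(* The cochain on the left is the cup product of the 1-cochain B with g, paired
   by evaluation. *)
Lemma cobound_leibniz (G : groupType) (R : pzRingType) (M N : lmodType R)
    (act : G -> {linear M -> M}) (actN : G -> {linear N -> N}) n
    (B : G -> {additive N -> M}) (g : ('I_n -> G) -> N) a b x :
  cobound act (fun y => B (y ord0) (g (ftail y))) (fcons a (fcons b x)) =
  act a (B b (g x)) - B (a * b)%g (g x) + B a (actN b (g x))
  - B a (cobound actN g (fcons b x)).
Proof.
rewrite !cobound_fcons dfaceS !fconsE [B a (_ + _)]raddfD opprD.
rewrite [RHS]addrA addrK -[RHS]addrA; congr (_ + (_ - _)).
rewrite -dface_map; congr (dface _ _).
by apply: funext => y; rewrite !fconsE.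
Qed.

(** * Maps modulo constants and derivations of free groups *)

Section PointedMaps.
Variables (R : pzRingType) (S : Type) (s0 : S) (N : lmodType R).

Definition pointed : {pred (S -> N)} := fun h => h s0 == 0.

Lemma pointed_submod_closed : submod_closed pointed.
Proof.
split=> [|a g h]; first by rewrite unfold_in eqxx.
rewrite !unfold_in => /eqP g0 /eqP h0.
by rewrite [X in X == _](_ : _ = a *: g s0 + h s0) // g0 h0 scaler0 addr0.
Qed.
HB.instance Definition _ :=
  GRing.isSubmodClosed.Build R (S -> N) pointed pointed_submod_closed.

Record pointed_map : Type :=
  PMap { pmap_fun :> S -> N; pmap_pointed : pmap_fun \in pointed }.
HB.instance Definition _ := [isSub for pmap_fun].
HB.instance Definition _ := [Choice of pointed_map by <:].
HB.instance Definition _ := [SubChoice_isSubLmodule of pointed_map by <:].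

Lemma pmap0 (q : pointed_map) : q s0 = 0.
Proof. exact/eqP/(pmap_pointed q). Qed.

Lemma pmapP (q r : pointed_map) : pmap_fun q =1 pmap_fun r -> q = r.
Proof. by move=> /funext e; apply: val_inj. Qed.

Lemma pmapDE (q r : pointed_map) s : (q + r) s = q s + r s. Proof. by []. Qed.
Lemma pmapZE a (q : pointed_map) s : (a *: q) s = a *: q s. Proof. by []. Qed.
Lemma pmap_zeroE s : (0 : pointed_map) s = 0. Proof. by []. Qed.
Lemma pmapNE (q : pointed_map) s : (- q) s = - q s. Proof. by []. Qed.

Lemma pmap_eval_linear s : linear (fun q : pointed_map => q s).
Proof. by []. Qed.
Definition pmap_eval s : {linear pointed_map -> N} := mklin (pmap_eval_linear s).

Lemma pmap_of_pointed (h : S -> N) : (fun s => h s - h s0) \in pointed.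
Proof. by rewrite unfold_in subrr. Qed.
Definition pmap_of (h : S -> N) : pointed_map := PMap (pmap_of_pointed h).

Lemma pmap_ofE h s : pmap_of h s = h s - h s0. Proof. by []. Qed.

Lemma pmap_of_linear : linear pmap_of.
Proof.
move=> a g h; apply: pmapP => s.
by rewrite pmapDE pmapZE !pmap_ofE scalerBr addrACA -opprD.
Qed.
End PointedMaps.

Section Coinduction.
Variables (R : pzRingType) (G : groupType) (S : Type) (s0 : S).
Variables (N : lmodType R) (act : G -> {linear N -> N}) (op : G -> S -> S).

Definition is_gset : Prop :=
  (forall s, op 1%g s = s) /\ (forall a b s, op (a * b)%g s = op a (op b s)).

Lemma map_act_linear a : linear (fun (h : S -> N) s => act a (h (op a^-1%g s))).
Proof. by move=> c g h; apply: funext => s; apply: linearP. Qed.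
Definition map_act a : {linear (S -> N) -> (S -> N)} := mklin (map_act_linear a).

(* S -> N modulo the constant maps is identified with the maps vanishing at s0;
   this is the quotient action. *)
Lemma pmap_act_linear a :
  linear (fun h : pointed_map s0 N => pmap_of s0 (map_act a h)).
Proof.
move=> c g h; rewrite [pmap_fun (_ + _)](_ : _ = c *: pmap_fun g + pmap_fun h) //.
by rewrite linearP pmap_of_linear.
Qed.
Definition pmap_act a : {linear pointed_map s0 N -> pointed_map s0 N} :=
  mklin (pmap_act_linear a).

Lemma pmap_actE a (h : pointed_map s0 N) s :
  pmap_act a h s = act a (h (op a^-1%g s)) - act a (h (op a^-1%g s0)).
Proof. by []. Qed.

Lemma pmap_of_equivariant a h :
  pmap_of s0 (map_act a h) = pmap_act a (pmap_of s0 h).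
Proof.
apply: pmapP => s; rewrite pmap_actE !pmap_ofE.
by rewrite !linearB /= opprK addrACA addNr addr0.
Qed.

Lemma map_act_action : is_action act -> is_gset -> is_action map_act.
Proof.
move=> [act1 actM] [op1 opM]; split=> [h|a b h]; apply: funext => s /=.
  by rewrite act1 invg1 op1.
by rewrite actM invgM opM.
Qed.

Lemma pmap_act_action : is_action act -> is_gset -> is_action pmap_act.
Proof.
move=> actP opP; have [m1 mM] := map_act_action actP opP.
split=> [h|a b h]; apply: pmapP => s.
  by rewrite pmap_actE actP.1 invg1 opP.1 opP.1 actP.1 pmap0 subr0.
rewrite pmap_actE invgM !opP.2 !actP.2 !pmap_actE !linearB.
by rewrite !opprK addrACA addNr addr0.
Qed.

End Coinduction.

Definition derivation (F : groupType) (N : zmodType) (act : F -> N -> N)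
    (z : F -> N) : Prop := forall a b, z (a * b)%g = z a + act a (z b).

(** This is the vanishing of H^1(F; N); principal derivations carry the sign n - a n. *)
Definition derivations_principal (F : groupType) (N : zmodType)
    (act : F -> N -> N) : Prop :=
  forall z, derivation act z -> exists n, forall a, z a = n - act a n.

Section Semidirect.
Variables (R : pzRingType) (F : groupType) (N : lmodType R).
Variables (act : F -> {linear N -> N}) (actP : is_action act).

(** Derivations from F to N are the homomorphic sections of the projection of this group to F, so
    the universal property of a free basis, which speaks of homomorphisms, yields derivations with
    prescribed values. *)
Record semidirect : Type := Semidirect { sd_mod : N; sd_grp : F }.
HB.instance Definition _ := gen_eqMixin semidirect.
HB.instance Definition _ := gen_choiceMixin semidirect.

Definition sd_one := Semidirect 0 1%g.
Definition sd_mul x y :=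
  Semidirect (sd_mod x + act (sd_grp x) (sd_mod y)) (sd_grp x * sd_grp y)%g.
Definition sd_inv x :=
  Semidirect (- act (sd_grp x)^-1%g (sd_mod x)) (sd_grp x)^-1%g.

Lemma sd_mulA : associative sd_mul.
Proof.
case: actP => _ actM x y z.
by rewrite /sd_mul /= mulgA actM linearD addrA.
Qed.
Lemma sd_mul1 : left_id sd_one sd_mul.
Proof. by case=> n a; rewrite /sd_mul /= mul1g actP.1 add0r. Qed.
Lemma sd_mulr1 : right_id sd_one sd_mul.
Proof. by case=> n a; rewrite /sd_mul /= mulg1 linear0 addr0. Qed.
Lemma sd_mulV : left_inverse sd_one sd_inv sd_mul.
Proof. by case=> n a; rewrite /sd_mul /= mulVg addNr. Qed.
Lemma sd_mulrV : right_inverse sd_one sd_inv sd_mul.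
Proof.
by case=> n a; rewrite /sd_mul /= mulgV linearN -actP.2 mulgV actP.1 subrr.
Qed.
HB.instance Definition _ := isGroup.Build semidirect
  sd_mulA sd_mul1 sd_mulr1 sd_mulV sd_mulrV.

Variables (I : Type) (x : I -> F) (xP : free_basis x).

Lemma free_derivation_exists (v : I -> N) :
  exists2 d : F -> N, derivation act d & forall i, d (x i) = v i.
Proof.
have [f [[fM fx] _]] := xP (fun i => Semidirect (v i) (x i)).
have [g [_ gU]] := xP x.
(* The F-component of [f] is an endomorphism that fixes the basis, hence the identity. *)
have fid a : sd_grp (f a) = a.
  have e1 : g = id by apply: gU; split.
  have e2 : g = sd_grp \o f by apply: gU; split=> [b c|i] /=; rewrite ?fM ?fx.
  by rewrite -[LHS]/((sd_grp \o f) a) -e2 e1.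
exists (sd_mod \o f) => [a b|i] /=; last by rewrite fx.
by rewrite fM /= fid.
Qed.

Lemma free_derivation_eq (d e : F -> N) : derivation act d -> derivation act e ->
  (forall i, d (x i) = e (x i)) -> d =1 e.
Proof.
move=> dM eM de a.
have [f [_ fU]] := xP (fun i => Semidirect (d (x i)) (x i)).
have ed : f = fun a => Semidirect (d a) a.
  by apply: fU; split=> // b c; rewrite dM.
have ee : f = fun a => Semidirect (e a) a.
  by apply: fU; split=> [b c|i]; rewrite ?eM ?de.
by have := congr1 (fun h => sd_mod (h a)) (etrans (esym ed) ee).
Qed.

End Semidirect.

(* H^1(F; Map(S, N) / N) = H^2(F; N) = 0, as Map(S, N) is acyclic for F: a
   derivation to the quotient lifts to Map(S, N), where it is principal. *)
Lemma pmap_derivations_principal (R : pzRingType) (F : groupType) (I : Type)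
    (x : I -> F) (S : Type) (s0 : S) (N : lmodType R) (act : F -> {linear N -> N})
    (op : F -> S -> S) (rho : S -> F) :
  free_basis x -> is_action act -> is_gset op ->
  (forall a s, rho (op a s) = (a * rho s)%g) ->
  derivations_principal (fun a => pmap_act s0 act op a).
Proof.
move=> xP actP opP rhoE z zM.
have [d dM dx] := free_derivation_exists (map_act_action actP opP) xP
  (fun i => pmap_fun (z (x i))).
have zd : z =1 fun a => pmap_of s0 (d a).
  apply: (free_derivation_eq (pmap_act_action s0 actP opP) xP zM) => [b c|i].
    rewrite dM -pmap_of_equivariant; apply: pmapP => s.
    by rewrite pmapDE !pmap_ofE opprD addrACA.
  by apply: pmapP => s; rewrite pmap_ofE dx pmap0 subr0.
(* The equivariant map [rho] makes [d] principal on all maps: expanding [d (rho s)] along rho s = a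
   (a^-1 rho s) gives d a = h - a h. *)
pose h s := d (rho s) s.
have hE a s : d a s = h s - act a (h (op a^-1%g s)).
  rewrite /h rhoE; have -> : d (rho s) = d (a * (a^-1 * rho s))%g.
    by rewrite mulgA mulgV mul1g.
  by rewrite dM [X in _ = X - _]/(d a s + _) addrK.
exists (pmap_of s0 h) => a; rewrite zd -pmap_of_equivariant; apply: pmapP => s.
rewrite pmapDE pmapNE !pmap_ofE !hE !opprD !opprK /=.
by rewrite addrACA.
Qed.

Section MapEval.
Variables (R : pzRingType) (S : Type) (N : lmodType R) (s : S).

Lemma map_eval_linear : linear (fun h : S -> N => h s).
Proof. by []. Qed.
Definition map_eval : {linear (S -> N) -> N} := mklin map_eval_linear.

End MapEval.

(** * Inflation from Aut F to the holomorph *)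

Section Contraction.
Variables (R : pzRingType) (G : groupType) (N : lmodType R).
Variables (act : G -> {linear N -> N}) (actP : is_action act).
Local Notation mul := (fun a b : G => (a * b)%g).

Lemma mul_gset : is_gset mul.
Proof. by split=> [s|a b s]; rewrite ?mul1g ?mulgA. Qed.

(** In homogeneous coordinates this puts the vertex s in front of 1, x_1, x_1 x_2, ...; it is the
    contracting homotopy of the coinduced module of maps from G to N. *)
Definition contraction n (u : ('I_n.+1 -> G) -> N) (x : 'I_n -> G) : G -> N :=
  fun s => act s (u (fcons s^-1%g x)).

Lemma contraction_homotopy n (u : ('I_n.+1 -> G) -> N) x s :
  cobound (map_act act mul) (contraction u) x s =
  u x - contraction (cobound act u) x s.
Proof.
rewrite -(fcons_eta x) cobound_fcons; move: (x ord0) (ftail x) => a {}x.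
rewrite /contraction cobound_fcons dfaceS linearD -actP.2 mulgV actP.1.
rewrite [LHS]/(act a (act (a^-1 * s)%g (u (fcons (a^-1 * s)^-1%g x))) + _).
rewrite -actP.2 mulgA mulgV mul1g invgM invgK linearB linearN.
rewrite opprD opprB. rewrite addrA subrr add0r opprK [RHS]addrC; congr (_ + _).
by rewrite -[LHS]/(map_eval N s _) -!dface_map.
Qed.

(** For a cocycle [u], the coboundary of the lift [contraction u] is the constant map [u], so the
    connecting map of N -> (G -> N) -> (G -> N) / N sends the class of [shift u] to that of [u]. *)
Definition shift n (u : ('I_n.+1 -> G) -> N) (x : 'I_n -> G) : pointed_map 1%g N :=
  pmap_of 1%g (contraction u x).

Lemma shift_cobound n (u : ('I_n.+1 -> G) -> N) x :
  cobound (pmap_act 1%g act mul) (shift u) x = - shift (cobound act u) x.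
Proof.
pose ofL := mklin (@pmap_of_linear R G 1%g N).
have ofP a h : ofL (map_act act mul a h) = pmap_act 1%g act mul a (ofL h).
  exact: pmap_of_equivariant.
rewrite [LHS](cobound_map ofP).
apply: pmapP => s; rewrite pmapNE !pmap_ofE !contraction_homotopy.
by rewrite opprB addrC opprB addrA subrK addrC.
Qed.

Lemma shift_normalized n (u : ('I_n.+1 -> G) -> N) :
  normalized u -> normalized (shift u).
Proof.
move=> uN x [i xi]; have u0 a : u (fcons a x) = 0.
  by apply: uN; exists (lift ord0 i); rewrite fcons_lift.
by apply: pmapP => s; rewrite pmap_ofE /contraction !u0 !linear0 addr0.
Qed.

Lemma shiftE n (u : ('I_n.+1 -> G) -> N) x s : normalized u ->
  shift u x s = act s (u (fcons s^-1%g x)).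
Proof.
move=> uN; rewrite pmap_ofE /contraction invg1 [u (fcons 1%g x)]uN.
  by rewrite linear0 subr0.
by exists ord0; rewrite fcons0.
Qed.

End Contraction.

Section Inflation.
Variables (R : pzRingType) (F : groupType).
Local Notation G := (holomorph F).

Definition hol_emb (a : F) : G := Holo a 1%g.

Lemma hol_embM a b : hol_emb (a * b)%g = (hol_emb a * hol_emb b)%g.
Proof. by congr Holo; rewrite /= mulg1. Qed.

Lemma hol_embV a : hol_emb a^-1%g = (hol_emb a)^-1%g.
Proof. by apply: (mulgI (hol_emb a)); rewrite -hol_embM !mulgV. Qed.

Lemma hol_emb_conj (x : G) a :
  exists b, (hol_emb a * x = x * hol_emb b)%g.
Proof.
case: x => [b f]; exists (f^-1 (b^-1 * a * b))%g.
congr Holo; rewrite /= ?mul1g ?mulg1 // autVK.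
by rewrite !mulgA mulgV mul1g.
Qed.

Lemma hol_aut_eq (x y : G) : hol_aut x = hol_aut y ->
  exists a, y = (x * hol_emb a)%g.
Proof.
case: x y => [a f] [b g] /= <-; exists (f^-1 (a^-1 * b))%g.
by congr Holo; rewrite /= ?mulg1 // autVK mulgA mulgV mul1g.
Qed.

Definition coset_invariant (N : Type) n (f : ('I_n -> G) -> N) : Prop :=
  forall x y, (forall i, hol_aut (x i) = hol_aut (y i)) -> f x = f y.

Lemma fcons_aut n (a b : G) (x y : 'I_n -> G) : hol_aut a = hol_aut b ->
  (forall i, hol_aut (x i) = hol_aut (y i)) ->
  forall i, hol_aut (fcons a x i) = hol_aut (fcons b y i).
Proof.
by move=> ab xy i; case: (unliftP ord0 i) => [j|] ->;
  rewrite ?fcons0 ?fcons_lift.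
Qed.

Lemma dface_coset_invariant (N : zmodType) n (f : ('I_n -> G) -> N) :
  coset_invariant f -> coset_invariant (dface f).
Proof.
elim: n f => [|n IHn] f fI x y xy /=; first by congr (- _); apply: fI => -[].
congr (- _ - _).
  apply: fI; apply: fcons_aut; last by move=> i; apply: xy.
  by rewrite !hol_autM !xy.
rewrite (IHn (fun z => f (fcons (x ord0) z)) _ _ (ftail y)) => [||i].
- congr (dface _ _); apply: funext => z; apply: fI.
  by apply: fcons_aut.
- by move=> z w zw; apply: fI; apply: fcons_aut.
- exact: xy.
Qed.

Section Inflated.
Variables (N : lmodType R) (act : G -> {linear N -> N}).

(** These are the cochains that come from Aut F with values in the F-invariants of N. *)
Definition inflated n (f : ('I_n -> G) -> N) : Prop :=
  coset_invariant f /\ forall a x, act (hol_emb a) (f x) = f x.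

Definition vanishes_on_kernel n (f : ('I_n -> G) -> N) : Prop :=
  forall x i, hol_aut (x i) = 1%g -> f x = 0.

(* Evaluating the cocycle identity with c in F after a gives
   f(a c, z) = f(a, c z). *)
Lemma coset_invariant_of_vanishing (n : nat) (f : ('I_n -> G) -> N) :
  vanishes_on_kernel f ->
  (forall x (j : 'I_n), hol_aut (x (lift ord0 j)) = 1%g -> dface f x = 0) ->
  coset_invariant f.
Proof.
elim: n f => [|n IHn] f f0 df0 x y xy; first by congr f; apply: fnil_eq.
(* With its first argument fixed, a cocycle need not remain a cocycle; the identity on faces of
   positive index does persist, which is why the hypothesis is about [dface]. *)
have fa a : coset_invariant (fun w => f (fcons a w)).
  apply: IHn => [w i wi|w j wj].
    by apply: (f0 _ (lift ord0 i)); rewrite fcons_lift.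
  have := df0 (fcons a w) (lift ord0 j).
  rewrite fcons_lift => /(_ wj); rewrite -(fcons_eta w) dfaceS.
  rewrite [f _](f0 _ (lift ord0 j)) ?fcons_lift //.
  by rewrite oppr0 sub0r => /eqP; rewrite oppr_eq0 => /eqP.
have step a (c : F) z : f (fcons (a * hol_emb c)%g z) = f (fcons a z).
  have e : dface (fun w => f (fcons a w)) (fcons (hol_emb c) z) = - f (fcons a z).
    case: n {IHn df0 x y xy} f z f0 fa => [|n] f z f0 fa.
      by rewrite dface0 ftail_fcons.
    rewrite -(fcons_eta z) dfaceS.
    rewrite [X in dface X](_ : _ = fun=> 0) ?dface_0 ?subr0.
      congr (- _); apply: fa; apply: fcons_aut => //.
      exact: mul1g.
    apply: funext => w; apply: (f0 _ (lift ord0 ord0)).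
    by rewrite fcons_lift fcons0.
  have := df0 (fcons a (fcons (hol_emb c) z)) ord0.
  rewrite fcons_lift fcons0 => /(_ erefl).
  by rewrite dfaceS e opprK => /eqP; rewrite addrC subr_eq0 => /eqP.
have [a ya] := hol_aut_eq (xy ord0).
rewrite -(fcons_eta x) -(fcons_eta y) ya step.
by apply: fa => i; apply: xy.
Qed.

(** For the invariance of values, the first argument a of the cocycle identity is taken in F. The
    terms that keep a vanish, merging a into x_1 does not change its coset, and a f(x) = f(x)
    remains. *)
Lemma inflated_of_vanishing n (f : ('I_n -> G) -> N) :
  (forall x, cobound act f x = 0) -> vanishes_on_kernel f -> inflated f.
Proof.
move=> df0 f0; have fI : coset_invariant f.
  apply: coset_invariant_of_vanishing => // x j xj.
  by have := df0 x; rewrite coboundE [f _](f0 _ j) // linear0 add0r.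
split=> // a x; have := df0 (fcons (hol_emb a) x); rewrite cobound_fcons.
case: n f x {df0} f0 fI => [|n] f x f0 fI.
  by rewrite dface0 ftail_fcons => /eqP; rewrite subr_eq0 => /eqP.
rewrite -(fcons_eta x) dfaceS [X in dface X](_ : _ = fun=> 0); last first.
  by apply: funext => y; apply: (f0 _ ord0); rewrite fcons0.
rewrite dface_0 subr0 [f (fcons (_ * _)%g _)](fI _ (fcons (x ord0) (ftail x))).
  by rewrite fcons_eta => /eqP; rewrite subr_eq0 => /eqP.
by apply: fcons_aut => //; apply: mul1g.
Qed.

End Inflated.

(* Injectivity of the inflation from Aut F, by dimension shifting from N to
   (G -> N) / N. A primitive t of the shifted cochain is corrected by constants
   k, found by principality, so that t + k becomes F-invariant in G -> N. *)
Lemma inflated_coboundary (I : Type) (e : I -> F) n (N : lmodType R)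
    (act : G -> {linear N -> N}) (u : ('I_n.+1 -> G) -> N) (b : ('I_n -> G) -> N) :
  free_basis e ->
  is_action act -> derivations_principal (fun a => act (hol_emb a)) ->
  normalized u -> inflated act u -> (forall x, cobound act u x = 0) ->
  normalized b -> (forall x, u x = cobound act b x) ->
  exists v, [/\ normalized v, inflated act v & forall x, u x = cobound act v x].
Proof.
move=> eP; elim: n N act u b => [|n IHn] N act u b actP prin uN [uI uinv] du bN ub.
  exists b; split=> //; split=> [x y _|a x]; first by congr b; apply: fnil_eq.
  (* On F the cochain [u] agrees with its value at 1, which is zero, so the degree 0 primitive [b]
     is F-invariant already. *)
  have := ub (fcons (hol_emb a) x).
  rewrite (uI _ (fcons 1%g x)); last exact: fcons_aut.
  rewrite uN; last by exists ord0; rewrite fcons0.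
  rewrite cobound_fcons dface0 ftail_fcons => /esym/eqP.
  by rewrite subr_eq0 => /eqP.
pose mul (a c : G) := (a * c)%g.
pose u' := shift act u; pose act' := pmap_act 1%g act mul.
have act'P : is_action act' := pmap_act_action 1%g actP (mul_gset G).
have prin' : derivations_principal (fun a => act' (hol_emb a)).
  have embP : is_action (fun a => act (hol_emb a)).
    by split=> [m|a c m]; rewrite ?actP.1 // hol_embM actP.2.
  have opP : is_gset (fun a : F => mul (hol_emb a)).
    by split=> [s|a c s]; rewrite /mul ?mul1g // hol_embM mulgA.
  (* F acts on G by left multiplication, and [hol_el] is an equivariant map from G to F. *)
  have := @pmap_derivations_principal _ _ _ _ _ 1%g _ _ _ (@hol_el F) eP embP opP
    (fun a s => erefl).
  congr derivations_principal; apply: funext => a; apply: funext => q.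
  by apply: pmapP => s; rewrite !pmap_actE hol_embV.
have u'E x s : u' x s = act s (u (fcons s^-1%g x)) by apply: shiftE.
have u'emb x a : u' x (hol_emb a)^-1%g = 0.
  rewrite u'E invgK (uI _ (fcons 1%g x)); last exact: fcons_aut.
  by rewrite uN ?linear0 //; exists ord0; rewrite fcons0.
have u'I : inflated act' u'.
  split=> [x y xy|a x]; apply: pmapP => s; first rewrite !u'E.
    by congr (act _ _); apply: uI; apply: fcons_aut.
  rewrite pmap_actE /mul mulg1 u'emb linear0 subr0 !u'E -actP.2 mulgA mulgV mul1g.
  rewrite invgM invgK; congr (act _ _); apply: uI; apply: fcons_aut => //.
  exact: mulg1.
have du' x : cobound act' u' x = 0.
  rewrite /act' /u' shift_cobound // [X in shift _ X](_ : _ = fun=> 0).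
    by apply/eqP; rewrite oppr_eq0; apply/eqP/pmapP => s; rewrite shiftE ?linear0.
  exact/funext.
have u'b x : u' x = cobound act' (fun y => - shift act b y) x.
  by rewrite coboundN /act' shift_cobound // opprK; congr shift; apply/funext.
have b'N : normalized (fun y => - shift act b y).
  by move=> x xi; rewrite shift_normalized ?oppr0.
have [t [tN [tI tinv] ut]] := IHn _ _ _ _ act'P prin' (shift_normalized act uN) u'I
   du' b'N u'b.
(* If q is F-invariant modulo constants, a |-> a q(a^-1) is a derivation of N; writing it as n - a n
   makes q + n invariant as a map. Requiring n = 0 at q = 0 keeps the chosen constants normalized,
   and 0 is the default for other q. *)
have cE (q : pointed_map (1%g : G) N) : exists n,
    (q = 0 -> n = 0) /\
    ((forall a, act' (hol_emb a) q = q) -> forall a,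
      act (hol_emb a) (q (hol_emb a)^-1%g) = n - act (hol_emb a) n).
  have [->|q0] := eqVneq q 0; first exists 0.
    by split=> // _ a; rewrite pmap_zeroE !linear0 addr0.
  have [qI|] := pselect (forall a, act' (hol_emb a) q = q); last first.
    by move=> nqI; exists 0; split=> // qI; case: nqI.
  have [a d|m mP] := prin (fun a => act (hol_emb a) (q (hol_emb a)^-1%g)).
    have := congr1 (fun r : pointed_map _ _ => r (hol_emb a)^-1%g) (qI d).
    rewrite pmap_actE /mul mulg1 => /eqP; rewrite subr_eq => /eqP e1.
    by rewrite hol_embM invgM actP.2 e1 linearD.
  by exists m; split=> [|_ //]; move/eqP: q0.
have [c cP] := choice cE.
pose k x := c (t x); pose h x := act (x ord0) (t (ftail x) (x ord0)^-1%g).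
have kN : normalized k by move=> x xi; apply: (cP _).1; apply: tN.
have T a y s : act (hol_emb a) (t y ((hol_emb a)^-1 * s)%g + k y) = t y s + k y.
  have := congr1 (fun r : pointed_map _ _ => r s) (tinv a y).
  rewrite pmap_actE /mul mulg1 ((cP (t y)).2 (tinv^~ y)) opprB => <-.
  by rewrite linearD -addrA subrK.
(* Since [shift u] is the coboundary of [t], the map [contraction u x] differs from the coboundary
   of t + k at x by a constant. This is that constant, read off at 1, where [contraction u x] and
   all values of [t] vanish. *)
exists (fun x => - h x - cobound act k x).
have vE x : - h x - cobound act k x =
    - act (x ord0) (t (ftail x) (x ord0)^-1%g + k (ftail x)) - dface k x.
  by rewrite coboundE opprD !linearD /h !addrA.
split.
- move=> x xi; rewrite [cobound act k x]cobound_normalized // subr0 /h.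
  case: xi => i; case: (unliftP ord0 i) => [j|] -> xi.
    by rewrite (tN (ftail x)) ?pmap_zeroE ?linear0 ?oppr0 //; exists j.
  by rewrite xi invg1 pmap0 linear0 oppr0.
- have kI : coset_invariant k by move=> y z yz; rewrite /k (tI y z).
  split=> [x y xy|a x]; rewrite !vE.
    rewrite (dface_coset_invariant kI xy) /k (tI (ftail x) (ftail y)); last first.
      by move=> i; apply: xy.
    by have [a ->] := hol_aut_eq (xy ord0); rewrite actP.2 invgM T.
  pose q := ftail x; pose r := (hol_emb a)^-1%g.
  have e0 : act (hol_emb a) (dface k x) =
      dface k x - act (hol_emb a) (dface (fun y => t y r) x).
    apply/eqP; rewrite eq_sym subr_eq -linearD -dfaceD -dface_map; apply/eqP.
    congr (dface _ x); apply: funext => y.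
    by have := T a y 1%g; rewrite mulg1 pmap0 add0r addrC.
  (* The equation between [u'] and the coboundary of [t] is evaluated at [r], which lies in F, where
     [u'] vanishes. *)
  have e1 : dface (fun y => t y r) x =
      act (x ord0) (t q (x ord0)^-1%g) - act (x ord0) (t q ((x ord0)^-1 * r)%g).
    have := congr1 (fun p : pointed_map _ _ => p r) (ut x).
    rewrite u'emb coboundE pmapDE pmap_actE /mul mulg1.
    rewrite -[dface t x r]/(@pmap_eval _ _ 1%g N r (dface t x)) -dface_map.
    by move/esym/eqP; rewrite addrC addr_eq0 opprB => /eqP.
  have e2 : act (x ord0) (t q (x ord0)^-1%g + k q) =
      act (hol_emb a) (act (x ord0) (t q ((x ord0)^-1 * r)%g + k q)).
    have [d ad] := hol_emb_conj (x ord0) a; rewrite -actP.2 ad.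
    have -> : ((x ord0)^-1 * r = (hol_emb d)^-1 * (x ord0)^-1)%g.
      by rewrite -!invgM ad.
    by rewrite actP.2 T.
  rewrite !(linearD (act (x ord0))) in e2 *.
  rewrite linearB (linearN (act _)) e0 e1 [in RHS]e2.
  rewrite !(linearD (act (hol_emb a))) (linearN (act (hol_emb a))).
  rewrite opprB opprD addrA [X in X + _]addrA [X in X + _ + _]addrAC addNr add0r.
  by rewrite opprD [X in X - _ = _]addrC.
- move=> x; rewrite -(fcons_eta x) -(fcons_eta (ftail x)).
  move: (x ord0) (ftail x ord0) (ftail (ftail x)) => a d {}x.
  rewrite coboundB coboundN cobound_cobound // subr0.
  pose B a := (act a \o @pmap_eval _ _ 1%g N a^-1%g
    : {linear pointed_map 1%g N -> N}).
  rewrite [cobound act h _](cobound_leibniz act act' B) -ut.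
  rewrite [RHS]/(- (act a (act d (t x d^-1%g)) - act (a * d)%g (t x (a * d)^-1%g)
    + act a (act' d (t x) a^-1%g) - act a (u' (fcons d x) a^-1%g))).
  rewrite [X in _ = - (X - _)](_ : _ = 0); last first.
    rewrite pmap_actE /mul mulg1 linearB -!actP.2 -invgM addrA subrK.
    exact: subrr.
  by rewrite sub0r opprK -/u' u'E invgK -actP.2 mulgV actP.1.
Qed.

End Inflation.

(** * Uniqueness of the Gysin image *)

Section Prism.
Variables (F : groupType).
Local Notation G := (holomorph F).

Lemma aut_morphV (f : autgroup F) a : f a^-1%g = (f a)^-1%g.
Proof. by apply: (mulgI (f a)); rewrite -aut_morph !mulgV aut_morph1. Qed.

Definition hol_lin (x : G) : G := Holo 1%g (hol_aut x).

Definition affine (x : G) (y : F) : F := (hol_el x * hol_aut x y)%g.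

Lemma affine_gset : is_gset affine.
Proof.
split=> [y|x z y]; rewrite /affine /= ?mul1g //.
by rewrite aut_morph mulgA.
Qed.

Lemma affine_linV (f : autgroup F) y :
  affine (Holo 1%g f)^-1%g y = (f^-1%g : autgroup F) y.
Proof.
suff e : affine (Holo 1%g f)^-1%g y = (f^-1%g (1^-1)%g * f^-1%g y)%g.
  by rewrite e invg1 aut_morph1 mul1g.
by [].
Qed.

(** The two sides are the two paths around a square of the prism, from r(1) to x through r(x) or
    through 1; this is what makes inner faces cancel. *)
Lemma hol_lin_emb (x : G) y :
  (hol_lin x * hol_emb (affine x^-1 y)^-1 = hol_emb y^-1 * x)%g.
Proof.
case: x => [a f]; rewrite /hol_lin /affine; congr Holo; rewrite /= ?mul1g ?mulg1 //.
by rewrite aut_morphV aut_morph !autVK invgM invgK.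
Qed.

(* For g_k = x_1 ... x_k and the projection r(g) = (y, hol_aut g) of G to the
   coset of Aut F given by y, which is G-equivariant jointly in y and g, this is
   the prism operator
   sum_i (-1)^i f[r(g_0) | ... | r(g_i) | g_i | ... | g_n] between r and the
   identity, written in inhomogeneous coordinates. *)
Fixpoint prism (M : zmodType) n :
    (('I_n.+1 -> G) -> M) -> ('I_n -> G) -> F -> M :=
  if n is n'.+1
  return (('I_n.+1 -> G) -> M) -> ('I_n -> G) -> F -> M then
    fun f x y => f (fcons (hol_emb y^-1) x) -
      prism (fun z => f (fcons (hol_lin (x ord0)) z)) (ftail x)
            (affine (x ord0)^-1%g y)
  else fun f x y => f (fcons (hol_emb y^-1) x).

Lemma prismS (M : zmodType) n (f : ('I_n.+2 -> G) -> M) a x y :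
  prism f (fcons a x) y = f (fcons (hol_emb y^-1) (fcons a x)) -
    prism (fun z => f (fcons (hol_lin a) z)) x (affine a^-1%g y).
Proof. by rewrite /= !fconsE. Qed.

Lemma prism_map (M N : zmodType) (u : {additive M -> N}) n
    (f : ('I_n.+1 -> G) -> M) x y :
  prism (fun z => u (f z)) x y = u (prism f x y).
Proof. by elim: n f x y => [|n IHn] f x y //=; rewrite raddfB IHn. Qed.

Lemma prismB (M : zmodType) n (f g : ('I_n.+1 -> G) -> M) x y :
  prism (fun z => f z - g z) x y = prism f x y - prism g x y.
Proof.
by elim: n f g x y => [|n IHn] f g x y //=; rewrite IHn !opprD !opprK addrACA.
Qed.

Lemma prism_0 (M : zmodType) n x y : prism (fun _ : 'I_n.+1 -> G => 0 : M) x y = 0.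
Proof. by elim: n x y => [|n IHn] x y //=; rewrite IHn subr0. Qed.

Lemma prismN (M : zmodType) n (f : ('I_n.+1 -> G) -> M) x y :
  prism (fun z => - f z) x y = - prism f x y.
Proof.
rewrite -[RHS]sub0r -[0 in RHS](prism_0 _ x y) -prismB.
by congr (prism _ x y); apply: funext => z; rewrite sub0r.
Qed.

Lemma prismD (M : zmodType) n (f g : ('I_n.+1 -> G) -> M) x y :
  prism (fun z => f z + g z) x y = prism f x y + prism g x y.
Proof.
rewrite -[prism g x y]opprK -prismN -prismB.
by congr (prism _ x y); apply: funext => z; rewrite opprK.
Qed.

(** This is the part of the prism homotopy without action. The faces of index 0, which involve the
    action, contribute the other end [f x] in [prism_homotopy]. *)
Lemma prism_dface (M : zmodType) n (f : ('I_n.+1 -> G) -> M) x y :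
  dface (fun z => prism f z y) x + prism (dface f) x y =
  - f (fun i => hol_lin (x i)).
Proof.
have linE m a (z : 'I_m -> G) :
    (fun i => hol_lin (fcons a z i)) = fcons (hol_lin a) (fun i => hol_lin (z i)).
  by apply: funext => i; case: (unliftP ord0 i) => [j|] ->;
    rewrite ?fcons0 ?fcons_lift.
have dE m (h : ('I_m.+1 -> G) -> M) a : (fun z => dface h (fcons a z)) =
    fun z => - h (fcons (a * z ord0)%g (ftail z)) - dface (fun w => h (fcons a w)) z.
  by apply: funext => z; rewrite -[in LHS](fcons_eta z) dfaceS fcons_eta.
have prism0 (h : ('I_1 -> G) -> M) (z : 'I_0 -> G) t :
  prism h z t = h (fcons (hol_emb t^-1) z) by [].
elim: n f x y => [|n IHn] f x y; rewrite -(fcons_eta x) linE;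
  move: (x ord0) (ftail x) => a {}x; rewrite prismS dE prismB prismN.
  rewrite !prism0 !dface0 !fconsE dfaceS dface0 !fconsE hol_lin_emb.
  rewrite [f (fcons (hol_lin a) x)](_ : _ =
      f (fcons (hol_lin a) (fun i => hol_lin (x i)))).
    by rewrite !opprD !opprK prism0 [- _ + f _]addrC addrA !addKr.
  by congr (f (fcons _ _)); apply: fnil_eq.
rewrite -(fcons_eta x) linE; move: (x ord0) (ftail x) => b {}x.
rewrite prismS !fconsE hol_lin_emb.
have := IHn (fun z => f (fcons (hol_lin a) z)) (fcons b x) (affine a^-1%g y).
rewrite linE => <-.
rewrite !dfaceS; under [X in - _ - dface X _]funext do rewrite prismS.
rewrite dfaceB prismS invgM.
have -> : affine b^-1%g (affine a^-1%g y) = affine (b^-1 * a^-1)%g y.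
  by rewrite affine_gset.2.
have -> : (fun z : 'I_n.+1 -> G => f (fcons (hol_lin a * fcons (hol_lin b) z ord0)%g
    (ftail (fcons (hol_lin b) z)))) = fun z => f (fcons (hol_lin (a * b)%g) z).
  apply: funext => z; rewrite !fconsE; congr (f (fcons _ _)).
  by congr Holo; rewrite /= mul1g aut_morph1.
set Q := prism _ x _; set S := dface _ _; set P := prism _ _ _; set E := dface _ _.
set T := f _; set T' := f _.
rewrite !opprD !opprK [- T' + _]addrC -[T' - Q + P]addrA [T + S - T' + _]addrA subrK.
rewrite [- T + Q + _]addrACA -opprD addrACA addNr add0r [Q + E]addrC -addrA.
by rewrite [Q + _]addrA subrr add0r.
Qed.
End Prism.

(** * Gysin sums as cocycles with values in maps modulo constants *)

Section LinearEval.
Variables (R : comPzRingType) (U V : lmodType R) (u : U).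

Lemma lhom_eval_linear : linear (fun f : {linear U -> V} => f u).
Proof. by []. Qed.
Definition lhom_eval : {linear {linear U -> V} -> V} := mklin lhom_eval_linear.

End LinearEval.

Lemma H1class1 (R : comPzRingType) (F : groupType) : H1class R (1%g : F) = 0.
Proof. by have := H1classM R (1 : F)%g 1%g; rewrite mulg1 -[LHS]addr0 => /addrI. Qed.

Section GysinUnique.
Variables (R : comPzRingType) (F : groupType) (M : lmodType R).
Variables (act : autgroup F -> {linear M -> M}) (actP : is_action act).
Local Notation G := (holomorph F).
Local Notation iact := (inflate act).

(** The right side does not depend on [y], so modulo constant maps [prism] anticommutes with the
    coboundary. *)
Lemma prism_homotopy n (f : ('I_n.+1 -> G) -> M) x y :
  cobound (map_act iact (@affine F)) (prism f) x y + prism (cobound iact f) x y =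
  f x - f (fun i => hol_lin (x i)).
Proof.
have -> : cobound iact f = fun z => iact (z ord0) (f (ftail z)) + dface f z.
  by apply: funext => z; rewrite coboundE.
rewrite prismD coboundE.
rewrite [X in X + _](_ : _ = iact (x ord0) (prism f (ftail x)
    (affine (x ord0)^-1%g y)) + dface (fun z => prism f z y) x); last first.
  by congr (_ + _); rewrite -[LHS]/(map_eval M y _) -dface_map.
rewrite addrACA prism_dface -(fcons_eta x) prismS !fconsE; congr (_ - _).
have -> : (fun z : 'I_n.+1 -> G => iact (fcons (hol_lin (x ord0)) z ord0)
    (f (ftail (fcons (hol_lin (x ord0)) z)))) = fun z => iact (x ord0) (f z).
  by apply: funext => z; rewrite !fconsE.
by rewrite prism_map addrC [iact (hol_emb _) _]actP.1 subrK.
Qed.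

Lemma prism_normalized n (f : ('I_n.+1 -> G) -> M) x y :
  normalized f -> (exists i, x i = 1%g) -> prism f x y = 0.
Proof.
elim: n f x y => [|n IHn] f x y fN [i xi]; first by case: i xi.
rewrite /= fN ?sub0r; last by exists (lift ord0 i); rewrite fcons_lift.
case: (unliftP ord0 i) xi => [j|] -> xi.
  by rewrite IHn ?oppr0 //; [exact: fcons_normalized|exists j].
rewrite [X in prism X](_ : _ = fun=> 0) ?prism_0 ?oppr0 //.
by apply: funext => z; apply: fN; exists ord0; rewrite fcons0 xi.
Qed.

(** Every term of the prism has one inserted argument in F. If x_i survives it is a second one;
    otherwise it has become [hol_lin] of x_i, which is 1, and normalization applies. *)
Lemma prism_filtered n (f : ('I_n.+1 -> G) -> M) x y i :
  normalized f -> filtered f -> hol_aut (x i) = 1%g -> prism f x y = 0.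
Proof.
elim: n f x y i => [|n IHn] f x y i fN f0 xi; first by case: i xi.
rewrite /= (f0 _ ord0 (lift ord0 i)) ?sub0r ?fcons0 ?fcons_lift //.
case: (unliftP ord0 i) xi => [j|] -> xi.
  rewrite (IHn _ _ _ j) ?oppr0 //; first exact: fcons_normalized.
  move=> z k l kl zk zl; apply: (f0 _ (lift ord0 k) (lift ord0 l));
    by rewrite ?fcons_lift ?(inj_eq lift_inj).
rewrite [X in prism X](_ : _ = fun=> 0) ?prism_0 ?oppr0 //.
by apply: funext => z; apply: fN; exists ord0; rewrite fcons0 /hol_lin xi.
Qed.

Lemma shuffle0 n (phi : 'I_n -> autgroup F) a :
  shuffle phi a ord0 = fcons (hol_emb a) (fun i => Holo 1%g (phi i)).
Proof.
apply: funext => i; rewrite /shuffle /fcons; case: unlift => //.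
by rewrite big_pred0 // invg1.
Qed.

Lemma shuffleS n (phi : 'I_n.+1 -> autgroup F) a i :
  shuffle phi a (lift ord0 i) =
    fcons (Holo 1%g (phi ord0)) (shuffle (ftail phi) ((phi ord0)^-1%g a) i).
Proof.
apply: funext => j; case: (unliftP ord0 j) => [k|] ->; last first.
  rewrite fcons0 /shuffle.
  by have -> : ord0 = lift (lift ord0 i) ord0 by [apply: val_inj]; rewrite liftK.
rewrite fcons_lift /shuffle; case: (unliftP i k) => [l|] ->; last first.
  rewrite !unlift_none -autM -invgM.
  suff -> : (\big[*%g/1%g]_(m < n.+1 | (m < lift ord0 i)%N) phi m =
      phi ord0 * \big[*%g/1%g]_(m < n | (m < i)%N) ftail phi m)%g by [].
  by rewrite big_mkcond big_ord_recl [in RHS]big_mkcond.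
have -> : lift ord0 (lift i l) = lift (lift ord0 i) (lift ord0 l).
  by apply: val_inj; rewrite /= /bump !add1n ltnS addnS.
by rewrite !liftK.
Qed.

(** Arguments from Aut F are fixed by [hol_lin], so only the inserted element of F changes from term
    to term. The inverse appears because the prism inserts y^-1, the step from r(1) to 1. *)
Lemma gysin_sum n (f : ('I_n.+1 -> G) -> M) (phi : 'I_n -> autgroup F) a :
  \sum_(i < n.+1) (-1) ^+ i *: f (shuffle phi a i) =
  prism f (fun i => Holo 1%g (phi i)) a^-1%g.
Proof.
elim: n f phi a => [|n IHn] f phi a.
  by rewrite big_ord1 scale1r shuffle0 /= invgK.
rewrite big_ord_recl scale1r shuffle0 /= invgK; congr (_ + _).
rewrite affine_linV aut_morphV.
rewrite -(IHn _ (ftail phi)) -sumrN; apply: eq_bigr => i _.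
by rewrite shuffleS exprS mulN1r scaleNr.
Qed.

Variables (I : Type) (e : I -> F) (eP : free_basis e).

(* In (F -> M) / M, the prism of f is inflated because f is filtered, and it is a
   coboundary because f is; the invariants of this module are the
   homomorphisms from F to M. *)
Lemma gysin_sum_coboundary n (f : ('I_n.+2 -> G) -> M)
    (g : ('I_n.+1 -> autgroup F) -> {linear H1 R F -> M}) :
  normalized f -> filtered f -> (forall x, cobound iact f x = 0) ->
  is_coboundary iact f ->
  (forall phi a, g phi (H1class R a) =
     \sum_(i < n.+2) (-1) ^+ i *: f (shuffle phi a i)) ->
  is_coboundary (hom_act (@H1act R F) act) g.
Proof.
move=> fN f0 df [b bN fb] gE.
have iactP : is_action iact := inflate_action actP.
pose act' := pmap_act 1%g iact (@affine F).
have act'P : is_action act' := pmap_act_action 1%g iactP (affine_gset F).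
pose K m (h : ('I_m.+1 -> G) -> M) x := pmap_of (1%g : F) (prism h x).
have KN m (h : ('I_m.+1 -> G) -> M) : normalized h -> normalized (K m h).
  move=> hN x xi; apply: pmapP => y.
  by rewrite pmap_ofE !prism_normalized // subrr.
have dK m (h : ('I_m.+1 -> G) -> M) x :
    cobound act' (K m h) x = - K m.+1 (cobound iact h) x.
  pose ofL := mklin (@pmap_of_linear R F 1%g M).
  have ofP a r : ofL (map_act iact (@affine F) a r) = act' a (ofL r).
    exact: pmap_of_equivariant.
  rewrite [LHS](cobound_map ofP); apply: pmapP => y.
  have E z : cobound (map_act iact (@affine F)) (prism h) x z =
      h x - h (fun i => hol_lin (x i)) - prism (cobound iact h) x z.
    by rewrite -(prism_homotopy h x z) addrK.
  have aux (c r s : M) : c - r - (c - s) = - (r - s).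
    by rewrite !opprB addrC addrA subrK.
  rewrite pmapNE [LHS]/(cobound _ _ x y - cobound _ _ x 1%g) !E pmap_ofE.
  exact: aux.
have dKf x : cobound act' (K _ f) x = 0.
  rewrite dK [cobound iact f](_ : _ = fun=> 0); last exact/funext.
  apply/eqP; rewrite oppr_eq0; apply/eqP/pmapP => y.
  by rewrite pmap_ofE !prism_0 subrr.
have uI : inflated act' (K _ f).
  apply: inflated_of_vanishing => // x i xi.
  by apply: pmapP => y; rewrite pmap_ofE !(prism_filtered _ fN f0 xi) subrr.
have prin : derivations_principal (fun a => act' (hol_emb a)).
  have embP : is_action (fun a => iact (hol_emb a)).
    by split=> [m|a c m]; rewrite ?iactP.1 // hol_embM iactP.2.
  have opP : is_gset (fun a : F => affine (hol_emb a)).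
    by split=> [s|a c s]; rewrite /affine /= ?mul1g ?mulgA.
  exact: (@pmap_derivations_principal _ _ _ _ _ 1%g _ _ _ id eP embP opP).
have [|||||v [vN [vI vinv] dv]] := @inflated_coboundary R F I e n _ act' (K _ f)
  (fun x => - K _ b x) eP act'P prin.
- exact: KN.
- exact: uI.
- exact: dKf.
- by move=> x xi; rewrite KN ?oppr0.
- by move=> x; rewrite coboundN dK opprK; congr (K _ _ _); exact/funext.
(* As F acts trivially on M, invariance modulo constants of a map vanishing at 1 means
   additivity. *)
have vM x a c : v x (a * c)%g = v x a + v x c.
  have := congr1 (fun r : pointed_map _ _ => r c) (vinv a^-1%g x).
  rewrite pmap_actE -hol_embV invgK /affine /= mulg1 ![act 1%g _]actP.1.
  by move/eqP; rewrite subr_eq addrC => /eqP.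
pose j (phi : autgroup F) : G := Holo 1%g phi.
have jM : {morph j : phi psi / (phi * psi)%g}.
  by move=> phi psi; congr Holo; rewrite /= mul1g aut_morph1.
(* The inverses match the point [a^-1] at which [gysin_sum] evaluates the prism. *)
have VM phi a c :
    v (j \o phi) (a * c)^-1%g = v (j \o phi) a^-1%g + v (j \o phi) c^-1%g.
  by rewrite invgM vM addrC.
pose V phi : {linear H1 R F -> M} := H1lift (VM phi).
exists V => [phi [i phi1]|phi]; apply: H1_ext => a.
  by rewrite H1liftE vN //; exists i; rewrite /= phi1.
rewrite coboundE lhomDE hom_actE H1actE H1liftE.
have -> : g phi (H1class R a) = K _ f (j \o phi) a^-1%g.
  (* The constant subtracted by [pmap_of] is the Gysin sum at the class of 1, which is zero. *)
  have p1 : prism f (j \o phi) 1%g = 0.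
    have := gysin_sum f phi 1%g; rewrite -gE H1class1 linear0 invg1.
    exact: esym.
  by rewrite pmap_ofE p1 subr0 gE gysin_sum.
rewrite dv coboundE pmapDE pmap_actE !affine_linV aut_morph1 pmap0 linear0 subr0.
rewrite -aut_morphV; congr (_ + _).
rewrite -[LHS]/(@pmap_eval _ _ 1%g M a^-1%g (dface v (j \o phi))).
rewrite -[RHS]/(lhom_eval M (H1class R a) (dface V phi)) -!dface_map -dface_comp //.
congr (dface _ phi); apply: funext => psi.
by rewrite -[RHS]/(V psi (H1class R a)) H1liftE.
Qed.
End GysinUnique.

Section GysinGraph.
Variables (R : comPzRingType) (F : groupType) (M : lmodType R).
Variables (act : autgroup F -> {linear M -> M}) (actP : is_action act).
Variables (I : Type) (e : I -> F) (eP : free_basis e).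

(** Two filtered representatives of a class differ by a filtered coboundary, whose Gysin sum is a
    coboundary. *)
Lemma gysin_graph_unique p (c : cohomology (inflate act) p.+2) d d' :
  gysin_graph c d -> gysin_graph c d' -> d = d'.
Proof.
move=> [f [g [fc f0 <- gE]]] [f' [g' [fc' f0' <- gE']]].
apply/cohclassP; apply: (gysin_sum_coboundary actP eP (f := fun x => f x - f' x)).
- by move=> x xi; rewrite !cocycle_normalized ?subrr.
- by move=> x i j ij xi xj; rewrite (f0 _ i j) // (f0' _ i j) // subrr.
- by move=> x; rewrite coboundB !cocycle_closed subrr.
- by apply/cohclassP; rewrite fc fc'.
- move=> phi a; rewrite [LHS]/(g phi (H1class R a) - g' phi (H1class R a)).
  by rewrite gE gE'; under [RHS]eq_bigr do rewrite scalerBr; rewrite sumrB.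
Qed.

Lemma gysin_graphE p (c : cohomology (inflate act) p.+2) d :
  gysin_graph c d -> gysin c = d.
Proof.
move=> cd; apply: (gysin_graph_unique _ cd).
by have := @xgetPex _ (cohclass (cocycle0 _ _)) [set d | gysin_graph c d]%classic;
  apply; exists d.
Qed.

End GysinGraph.

Lemma cup_powS (R : comPzRingType) (G : groupType) (M : lmodType R)
    (act : G -> {linear M -> M}) (f : ('I_1 -> G) -> M) p y :
  cup_pow act f (y : 'I_p.+1 -> G) =
  tens (f (fun=> y ord0)) (tpow_act act p (y ord0) (cup_pow act f (ftail y))).
Proof.
rewrite /= /cup big_ord1; congr (tens (f _) (tpow_act act p _ (cup_pow act f _))).
- by apply: funext => j; rewrite (ord1 j); congr y; apply: val_inj.
- by congr y; apply: val_inj.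
- by apply: funext => j; congr y; apply: val_inj.
Qed.

(** * The Johnson cocycle *)

Section TensIdr.
Variables (R : comPzRingType) (F : groupType).
Local Notation H := (H1 R F).
Local Notation hact := (@H1act R F).

Lemma tens_idr_equivariant x (u : {linear H -> tpow H 2}) p t :
  tens_idr (target_act R 2 x u) p (tpow_act hact p.+1 x t) =
  tpow_act hact p.+2 x (tens_idr u p t).
Proof.
suff e : (tens_idr (target_act R 2 x u) p \o tpow_act hact p.+1 x
         : {linear tpow H p.+1 -> tpow H p.+2}) =
         tpow_act hact p.+2 x \o tens_idr u p.
  by rewrite -[LHS]lcompE e.
apply: tensor_ext => v s; rewrite !lcompE.
rewrite [tpow_act _ p.+1 x (tens v s)]tpow_mapS !tens_idrE.
rewrite [target_act _ _ _ _ _]hom_actE -(@H1act_action R F).2 mulVg.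
rewrite (@H1act_action R F).1; exact: (esym (tpow_map_cat (hact x) (u v) s)).
Qed.

Lemma tens_idrD (u u' : {linear H -> tpow H 2}) p :
  tens_idr (u + u') p = tens_idr u p + tens_idr u' p.
Proof. exact: (linearD (mklin (@tens_idr_linear R H p))). Qed.

Lemma tens_idr0 p : tens_idr (0 : {linear H -> tpow H 2}) p = 0.
Proof. exact: (linear0 (mklin (@tens_idr_linear R H p))). Qed.

Lemma tcatD (t t' : tpow H 2) p (s : tpow H p) :
  tcat (t + t') s = tcat t s + tcat t' s.
Proof. exact: linearD. Qed.

Lemma tcatN (t : tpow H 2) p (s : tpow H p) : tcat (- t) s = - tcat t s.
Proof. exact: linearN. Qed.

End TensIdr.

(** * A filtered cocycle representing the power of [k0] *)

Section Representative.
Variables (R : comPzRingType) (F : groupType) (theta : F -> ctensor R F).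
Variable thetaP : magnus_expansion theta.
Local Notation H := (H1 R F).
Local Notation G := (holomorph F).
Local Notation hact := (@H1act R F).
Local Notation iact := (inflate (@H1act R F)).
Local Notation tau := (johnson thetaP).

Lemma inflate_tpow_action p : is_action (tpow_act iact p).
Proof. exact: tpow_act_action (inflate_action (@H1act_action R F)) p. Qed.

Lemma theta2_1 : theta 1%g 2 = 0.
Proof.
have := magnus2M thetaP 1%g 1%g; rewrite mulg1 H1class1 tens0l addr0.
by rewrite -[LHS]addr0 => /addrI.
Qed.

Lemma johnson1 : tau 1%g = 0.
Proof.
have := johnsonM thetaP 1%g 1%g; rewrite mulg1 (target_act_action _ _ _).1.
by rewrite -[LHS]addr0 => /addrI.
Qed.

(** Applied to g(x_2, ...) at x = x_1, this is the cup product of tau with g, followed by evaluation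
    of tau on the first tensor factor. *)
Definition johnson_mul p (x : G) : {linear tpow H p.+1 -> tpow H p.+2} :=
  tens_idr (tau (hol_aut x)) p \o tpow_act iact p.+1 x.

(** The cocycle identity of tau, in the form that cancels the first three terms of
    [cobound_leibniz]. *)
Lemma johnson_mulM p x y t :
  tpow_act iact p.+2 x (johnson_mul p y t) - johnson_mul p (x * y)%g t +
  johnson_mul p x (tpow_act iact p.+1 y t) = 0.
Proof.
rewrite /johnson_mul !lcompE hol_autM johnsonM tens_idrD lhomDE.
rewrite -[tpow_act iact p.+2 x _](tens_idr_equivariant (hol_aut x)).
rewrite -[tpow_act hact p.+1 _ _](inflate_tpow_action p.+1).2.
by rewrite opprD addrA addrAC subrK subrr.
Qed.

Lemma johnson_mul_kernel p x : hol_aut x = 1%g -> johnson_mul p x = 0.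
Proof.
move=> x1; apply: linear_ext => t.
by rewrite /johnson_mul lcompE x1 johnson1 tens_idr0.
Qed.

Fixpoint johnson_rep p : ('I_p.+1 -> G) -> tpow H p.+1 :=
  if p is q.+1 return ('I_p.+1 -> G) -> tpow H p.+1 then
    fun x => - johnson_mul q (x ord0) (johnson_rep (ftail x))
  else fun x => tdeg1 (k0 R (x ord0)).

Lemma johnson_repS p (x : 'I_p.+2 -> G) :
  johnson_rep x = - johnson_mul p (x ord0) (johnson_rep (ftail x)).
Proof. by []. Qed.

Lemma johnson_rep_normalized p : normalized (@johnson_rep p).
Proof.
elim: p => [|p IHp] x [i xi].
  have xi0 : x ord0 = 1%g by case: (unliftP ord0 i) xi => [[]|->].
  by rewrite /= xi0 /k0 H1class1 /tdeg1 tens0l.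
rewrite johnson_repS; case: (unliftP ord0 i) xi => [j|] -> xi.
  rewrite (IHp (ftail x)) ?[johnson_mul _ _ _]linear0 ?oppr0 //.
  by exists j.
by rewrite xi johnson_mul_kernel // oppr0.
Qed.

(** All arguments but the last enter through tau, which vanishes at the identity, so at most the
    last one can lie in F. *)
Lemma johnson_rep_filtered p : filtered (@johnson_rep p).
Proof.
elim: p => [|p IHp] x i j; first by rewrite !ord1 eqxx.
case: (unliftP ord0 i) => [i'|] ->; last first.
  by move=> _ xi _; rewrite johnson_repS johnson_mul_kernel // oppr0.
case: (unliftP ord0 j) => [j'|] ->; last first.
  by move=> _ _ xj; rewrite johnson_repS johnson_mul_kernel // oppr0.
rewrite (inj_eq lift_inj) => ij xi xj.
by rewrite johnson_repS (IHp _ i' j') // [johnson_mul _ _ _]linear0 oppr0.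
Qed.

Lemma johnson_rep0 x : johnson_rep (x : 'I_1 -> G) = cup_pow iact (k0_cocycle R F) x.
Proof. by rewrite cup_powS. Qed.

Lemma johnson_rep_closed p x : cobound (tpow_act iact p.+1) (@johnson_rep p) x = 0.
Proof.
elim: p x => [|p IHp] x.
  rewrite (_ : @johnson_rep 0 = cup_pow iact (k0_cocycle R F) (p:=1)).
    exact: (cup_pow_closed (inflate_action (@H1act_action R F))).
  exact/funext/johnson_rep0.
rewrite -(fcons_eta x) -(fcons_eta (ftail x)) coboundN.
rewrite (cobound_leibniz _ (tpow_act iact p.+1) (johnson_mul p)).
by rewrite johnson_mulM IHp raddf0 subr0 oppr0.
Qed.

Definition johnson_rep_cocycle p : cocycle (tpow_act iact p.+1) p.+1 :=
  Cocycle (@johnson_rep_normalized p) (@johnson_rep_closed p).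

(** Only the shuffle with the element of F in the last place survives, and its sign (-1)^p cancels
    the sign carried by [johnson_rep]. *)
Lemma johnson_rep_gysin p (phi : 'I_p -> autgroup F) a :
  \sum_(i < p.+1) (-1) ^+ i *: johnson_rep (shuffle phi a i) =
  varsigma H p (cup_pow (target_act R 2) (johnson_cocycle thetaP) phi)
    (H1class R a).
Proof.
elim: p phi a => [|p IHp] phi a.
  by rewrite big_ord1 scale1r shuffle0 /= scale1r fcons0.
rewrite big_ord_recl shuffle0 scale1r johnson_repS fcons0.
rewrite johnson_mul_kernel // oppr0 add0r cup_powS varsigmaSE lcompE.
rewrite varsigma_equivariant hom_actE H1actE -IHp linear_sum linear_sum.
apply: eq_bigr => i _.
rewrite shuffleS johnson_repS !fconsE [tpow_act _ _ _ (_ *: _)]linearZZ.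
by rewrite [tens_idr _ _ _]linearZZ exprS mulN1r scaleNr scalerN opprK.
Qed.

Lemma cup_pow_johnson_mul p a b t :
  johnson_mul p a (tens (k0 R b) (tpow_act iact p b t)) =
  tcat (tau (hol_aut a) (H1class R (hol_aut a (hol_el b))))
       (tpow_act iact p (a * b)%g t).
Proof.
rewrite /johnson_mul lcompE (inflate_tpow_action p).2 [tpow_act _ p.+1 a _]tpow_mapS tens_idrE.
by rewrite /inflate H1actE.
Qed.

Definition theta2_mul p (x : G) : {linear tpow H p -> tpow H p.+2} :=
  mklin (@tcat_linearr R H 2 p (theta (hol_el x) 2)) \o tpow_act iact p x.

Lemma theta2_mulE p x t :
  theta2_mul p x t = tcat (theta (hol_el x) 2) (tpow_act iact p x t).
Proof. by []. Qed.

(* On the holomorph, the coboundary of theta_2 is the difference of k0 cup k0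
   and its fibrewise part, which is given by the Johnson cocycle. *)
Lemma theta2_mulM p a b t :
  tpow_act iact p.+2 a (theta2_mul p b t) - theta2_mul p (a * b)%g t +
  theta2_mul p a (tpow_act iact p b t) =
  - johnson_mul p a (tens (k0 R b) (tpow_act iact p b t))
  - tens (k0 R a) (tpow_act iact p.+1 a (tens (k0 R b) (tpow_act iact p b t))).
Proof.
rewrite cup_pow_johnson_mul !theta2_mulE johnsonE.
rewrite [tpow_act iact p.+1 a _]tpow_mapS [tpow_map _ p _](esym ((inflate_tpow_action p).2 _ _ _)).
have -> : tpow_act iact p.+2 a (tcat (theta (hol_el b) 2) (tpow_act iact p b t)) =
    tcat (tpow_act iact 2 a (theta (hol_el b) 2)) (tpow_act iact p (a * b)%g t).
  rewrite (inflate_tpow_action p).2.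
  exact: (tpow_map_cat (iact a) (theta (hol_el b) 2 : tpow H 2)).
have -> : hol_el (a * b)%g = (hol_el a * hol_aut a (hol_el b))%g by [].
have -> : ((hol_aut a)^-1)%g (hol_aut a (hol_el b)) = hol_el b by apply: aut_funK.
rewrite (magnus2M thetaP) !tcatD tcatN.
move: (tpow_act iact p (a * b)%g t) => s.
have -> : tcat (tens (H1class R (hol_el a))
      (tdeg1 (H1class R (hol_aut a (hol_el b)))) : tpow H 2) s =
    tens (k0 R a) (tens (iact a (k0 R b)) s).
  rewrite [LHS]tcatS [tcat (tdeg1 _) _]tcatS [tcat _ s]tcat0 scale1r.
  by rewrite /k0 /inflate H1actE.
rewrite -[tpow_map (hact (hol_aut a)) 2 _]/(tpow_act iact 2 a _).
move: (tcat _ s) (tcat _ s) (tcat _ s) (tens _ _) => C A B D.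
rewrite opprB -addrA [X in B + X]addrC -[A + C + D]addrA.
by rewrite opprD [A + _]addrA subrr add0r opprD [LHS]addrA.
Qed.

Fixpoint primitive p : ('I_p -> G) -> tpow H p.+1 :=
  if p is q.+1 return ('I_p -> G) -> tpow H p.+1 then
    fun x => johnson_mul q (x ord0) (primitive (ftail x)) -
      theta2_mul q (x ord0) (cup_pow iact (k0_cocycle R F) (ftail x))
  else fun=> 0.

Lemma primitiveS p (x : 'I_p.+1 -> G) : primitive x =
  johnson_mul p (x ord0) (primitive (ftail x)) -
  theta2_mul p (x ord0) (cup_pow iact (k0_cocycle R F) (ftail x)).
Proof. by []. Qed.

Lemma primitive_normalized p : normalized (@primitive p).
Proof.
elim: p => [|p IHp] x [i xi] //; rewrite primitiveS.
case: (unliftP ord0 i) xi => [j|] -> xi.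
  have xj : exists j, ftail x j = 1%g by exists j.
  rewrite (IHp _ xj) [cup_pow _ _ _](cup_pow_normalized _ xj).
  by rewrite [johnson_mul _ _ _]linear0 [theta2_mul _ _ _]linear0 subr0.
rewrite xi johnson_mul_kernel // theta2_mulE [theta _ 2]theta2_1.
by rewrite [tcat 0 _]linear0 subr0.
Qed.

(** The [theta2_mul] part trades the first two factors of the power of [k0] for -tau k0, and the
    [johnson_mul] part treats the remaining factors by induction. The intermediate cochain, tau
    applied to a lower power of [k0], occurs in both and cancels. *)
Lemma primitive_cobound p x :
  cobound (tpow_act iact p.+1) (@primitive p) x =
  cup_pow iact (k0_cocycle R F) x - johnson_rep x.
Proof.
elim: p x => [|p IHp] x.
  by rewrite johnson_rep0 subrr coboundE dface0 linear0 oppr0 addr0.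
rewrite -(fcons_eta x) -(fcons_eta (ftail x)).
move: (x ord0) (ftail x ord0) (ftail (ftail x)) => a b {}x.
rewrite coboundB (cobound_leibniz _ (tpow_act iact p.+1) (johnson_mul p)).
rewrite (cobound_leibniz _ (tpow_act iact p) (theta2_mul p)).
rewrite johnson_mulM theta2_mulM IHp.
rewrite (cup_pow_closed (inflate_action (@H1act_action R F))).
rewrite johnson_repS !cup_powS !fconsE.
rewrite -[LHS]/(0 - johnson_mul p a (_ - _) -
  (- johnson_mul p a _ - _ - theta2_mul p a 0)).
rewrite [theta2_mul p a 0]linear0 [johnson_mul p a (_ - _)]linearB.
by rewrite sub0r subr0 opprB opprD !opprK [LHS]addrA subrK addrC.
Qed.

Lemma johnson_rep_gysin_graph p :
  gysin_graph (cohclass (cocycle_pow (inflate_action (@H1act_action R F))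
                          (k0_cocycle R F) p.+1))
    (varsigma_star (cohclass (cocycle_pow (@target_act_action R F 2)
                                          (johnson_cocycle thetaP) p))).
Proof.
exists (johnson_rep_cocycle p).
exists (cocycle_map (@varsigma_equivariant R F p)
  (cocycle_pow (@target_act_action R F 2) (johnson_cocycle thetaP) p)).
split; last by move=> phi a; rewrite johnson_rep_gysin.
- apply/cohclassP; exists (fun x => - primitive x) => [x xi|x].
    by rewrite primitive_normalized ?oppr0.
  by rewrite coboundN primitive_cobound opprB.
- exact: johnson_rep_filtered.
- by rewrite /varsigma_star coh_mapE.
Qed.

End Representative.

(** * The classes [hclass] as images of powers of the Johnson class *)

Theorem theorem4p1 (R : comPzRingType) (n : nat) (hn : (2 <= n)%N)
    (F : groupType) (x : 'I_n -> F) (hF : free_basis x)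
    (theta : F -> ctensor R F) (htheta : magnus_expansion theta) :
  [/\ forall p, (1 <= p)%N ->
        hclass R F p =
          varsigma_star (cohclass (cocycle_pow (@target_act_action R F 2)
                                     (johnson_cocycle htheta) p)),
      cohclass (johnson_cocycle htheta) = hclass R F 1 &
      forall (theta' : F -> ctensor R F) (htheta' : magnus_expansion theta'),
        cohclass (johnson_cocycle htheta') = cohclass (johnson_cocycle htheta)].
Proof.
have hE (th : F -> ctensor R F) (thP : magnus_expansion th) p : (1 <= p)%N ->
    hclass R F p = varsigma_star (cohclass (cocycle_pow
      (@target_act_action R F 2) (johnson_cocycle thP) p)).
  case: p => // p _; apply: (gysin_graphE _ hF).
    exact: tpow_act_action (@H1act_action R F) p.+2.
  exact: johnson_rep_gysin_graph.
(* Since [hclass] does not involve the expansion, this also gives independence of theta. *)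
have h1 (th : F -> ctensor R F) (thP : magnus_expansion th) :
    cohclass (johnson_cocycle thP) = hclass R F 1.
  rewrite (hE _ thP) // /varsigma_star coh_mapE; apply/cohclassP.
  (* The two sides agree as cocycles: the first cup power is tau followed by the tensor unit, which
     [varsigma] in degree 1 removes. *)
  apply: is_coboundary_ext (is_coboundary0 _ 1) => y.
  apply/esym/eqP; rewrite subr_eq0; apply/eqP/esym.
  rewrite [LHS]/(varsigma _ 1 (cup_pow _ _ _)) cup_powS.
  exact: (varsigma1E (johnson thP (y ord0))).
by split=> [p|//|theta' htheta']; [exact: hE|rewrite !h1].
Qed.
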